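(* Let $\mathcal C$ be a strict monoidal category with an action $\varphi$ of a group $G$, and let $(\mathcal Z_G(\mathcal C),\odot,(\mathbf 1,\mathrm{id}))$ be the $G$-graded strict monoidal category with homogeneous components $\mathcal Z_g(\mathcal C)$. Then: (1) For each $g\in G$, the functor $\Phi_g:\mathcal Z_G(\mathcal C)\to\mathcal Z_G(\mathcal C)$ is strong comonoidal with $\Phi_g^2((X,\gamma_X),(Y,\gamma_Y)):=\varphi_g^2(X,Y)$ and $\Phi_g^0:=\varphi_g^0$. (2) With compositors $\Phi_{g,h,(X,\gamma_X)}:=\varphi_{g,h,X}$, the assignment $g\mapsto\Phi_g$ is an action of $G$ on $\mathcal Z_G(\mathcal C)$, and this action is $G$-crossed: $\Phi_g(\mathcal Z_h(\mathcal C))\subset\mathcal Z_{ghg^{-1}}(\mathcal C)$ for all $g,h$. (3) The morphisms $c_{(X,\gamma^g_X),(Y,\gamma^h_Y)}:=\gamma^g_{X,Y}:X\otimes Y\to\varphi_g(Y)\otimes X$ form a $G$-braiding on this $G$-crossed category. In particular $\mathcal Z_G(\mathcal C)$ is a $G$-braided category whose neutral component $\mathcal Z_e(\mathcal C)$ is the Drinfeld center of $\mathcal C$.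
   Context: All monoidal categories are strict. Comonoidal functor $(F,F^2,F^0)$: $F^0:F\mathbf 1\to\mathbf 1$, $F^2(X,Y):F(X\otimes Y)\to FX\otimes FY$ natural with $(F^2(X,Y)\otimes FZ)F^2(X\otimes Y,Z)=(FX\otimes F^2(Y,Z))F^2(X,Y\otimes Z)$, $(FX\otimes F^0)F^2(X,\mathbf 1)=\mathrm{id}=(F^0\otimes FX)F^2(\mathbf 1,X)$; strong if $F^2,F^0$ invertible ($F^{-2}$ = inverse of $F^2$); composites and comonoidal transformations as usual ($(GF)^2=G^2(F-,F-)G(F^2)$; $\alpha:F\to K$ comonoidal iff $(\alpha\otimes\alpha)F^2=K^2\alpha$, $K^0\alpha_{\mathbf 1}=F^0$). An action of $G$ on a monoidal category $\mathcal D$: comonoidal endofunctors $\varphi_g$ with $\varphi_e=\mathrm{Id}$, and comonoidal natural isomorphisms $\varphi_{g,h}:\varphi_g\varphi_h\to\varphi_{gh}$ (components $\varphi_{g,h,X}$) such that $\varphi_{gh,k,X}\varphi_{g,h,\varphi_kX}=\varphi_{g,hk,X}\varphi_g(\varphi_{h,k,X})$ and $\varphi_{g,e,X}=\mathrm{id}=\varphi_{e,g,X}$. Notation: $\varphi_{g_1,\dots,g_n,V}:=\varphi_{g_1\cdots g_{n-1},g_n,V}\varphi_{g_1,\dots,g_{n-1},\varphi_{g_n}V}$; $g.u:=\varphi_g^2(B_1,B_2)\varphi_g(u)\varphi_g^{-2}(A_1,A_2)$ for $u:A_1\otimes A_2\to B_1\otimes B_2$. An $F$-half-braiding on $X$: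 isomorphisms $\gamma_{X,V}:X\otimes V\to FV\otimes X$ natural in $V$ with $(F^2(V,W)\otimes X)\gamma_{X,V\otimes W}=(FV\otimes\gamma_{X,W})(\gamma_{X,V}\otimes W)$ and $(F^0\otimes X)\gamma_{X,\mathbf 1}=\mathrm{id}$. $\mathcal Z_g(\mathcal C)$: pairs $(X,\gamma^g_X)$ with $\gamma^g_X$ a $\varphi_g$-half-braiding; morphisms are morphisms $f$ of $\mathcal C$ with $(\varphi_gV\otimes f)\gamma_{X_1,V}=\gamma_{X_2,V}(f\otimes V)$. $\mathcal Z_G(\mathcal C)=\coprod_g\mathcal Z_g(\mathcal C)$ with $(X,\gamma^g_X)\odot(Y,\gamma^h_Y)=(X\otimes Y,\gamma_{X\otimes Y})$, $\gamma_{X\otimes Y,V}=(\varphi_{g,h,V}\otimes XY)(\gamma^g_{X,\varphi_hV}\otimes Y)(X\otimes\gamma^h_{Y,V})$, and $f\odot f'=f\otimes f'$. $\Phi_\ell$ sends $(X,\gamma^h_X)$ to $(\varphi_\ell X,\gamma_{\ell X})$ with $\gamma_{\ell X,V}=(\varphi_{\ell,h,\ell^{-1},V}\otimes\varphi_\ell X)\circ\ell.(\gamma^h_{X,\varphi_{\ell^{-1}}V})\circ(\varphi_\ell X\otimes\varphi^{-1}_{\ell,\ell^{-1},V})$, and a morphism $f$ to $\varphi_\ell(f)$. A $G$-graded monoidal category $\mathcal D=\coprod_g\mathcal D_g$ (with $\mathcal D_g\otimes\mathcal D_h\subset\mathcal D_{gh}$) with action $\psi$ is $G$-crossed if $\psi_g(\mathcal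 D_h)\subset\mathcal D_{ghg^{-1}}$. A $G$-braiding is a family of isomorphisms $c_{X,Y}:X\otimes Y\to\psi_{|X|}(Y)\otimes X$ natural in homogeneous $X$ (of degree $|X|$) and $Y$, such that for $X\in\mathcal D_g,Y\in\mathcal D_h$, $Z$ arbitrary: (i) $c_{X\otimes Y,Z}=(\psi_{g,h,Z}\otimes X\otimes Y)(c_{X,\psi_hZ}\otimes Y)(X\otimes c_{Y,Z})$; (ii) $\psi_g^2(Y,Z)\otimes X\circ c_{X,Y\otimes Z}=(\psi_gY\otimes c_{X,Z})(c_{X,Y}\otimes Z)$, i.e. $(\psi_g^2(Y,Z)\otimes X)c_{X,Y\otimes Z}=(\psi_gY\otimes c_{X,Z})(c_{X,Y}\otimes Z)$; (iii) for all $k$: $(\psi_{k,g,Y}\otimes\psi_kX)\psi_k^2(\psi_gY,X)\psi_k(c_{X,Y})=(\psi_{kgk^{-1},k,Y}\otimes\psi_kX)c_{\psi_kX,\psi_kY}\psi_k^2(X,Y)$. *)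

(* Defs.v *)
From Stdlib Require Import ClassicalEpsilon.

Set Implicit Arguments.

Record Grp := {
  gcar :> Type;
  gmul : gcar -> gcar -> gcar;
  gone : gcar;
  ginv : gcar -> gcar;
  gmulA : forall x y z, gmul x (gmul y z) = gmul (gmul x y) z;
  gmul1l : forall x, gmul gone x = x;
  gmul1r : forall x, gmul x gone = x;
  gmulVl : forall x, gmul (ginv x) x = gone;
  gmulVr : forall x, gmul x (ginv x) = gone }.
Arguments gmul {g} _ _.
Arguments gone {g}.
Arguments ginv {g} _.

Record MonCat := {
  ob : Type;
  ar : Type;
  isob : ob -> Prop;
  isar : ar -> Prop;
  dom : ar -> ob;
  cod : ar -> ob;
  idm : ob -> ar;
  comp : ar -> ar -> ar;        (* comp f g = f o g  (g first) *)
  munit : ob;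
  tens : ob -> ob -> ob;
  tensm : ar -> ar -> ar }.
Arguments isob {m} _.
Arguments isar {m} _.
Arguments dom {m} _.
Arguments cod {m} _.
Arguments idm {m} _.
Arguments comp {m} _ _.
Arguments tens {m} _ _.
Arguments tensm {m} _ _.

Definition hom (C : MonCat) (f : ar C) (X Y : ob C) : Prop :=
  isar f /\ dom f = X /\ cod f = Y.

Record is_strict_monoidal (C : MonCat) : Prop := {
  sm_ends : forall f : ar C, isar f -> isob (dom f) /\ isob (cod f);
  sm_idm : forall X : ob C, isob X -> hom C (idm X) X X;
  sm_comp : forall f g : ar C, isar f -> isar g -> dom f = cod g ->
      hom C (comp f g) (dom g) (cod f);
  sm_idl : forall f : ar C, isar f -> comp (idm (cod f)) f = f;
  sm_idr : forall f : ar C, isar f -> comp f (idm (dom f)) = f;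
  sm_assoc : forall f g h : ar C, isar f -> isar g -> isar h ->
      dom f = cod g -> dom g = cod h -> comp f (comp g h) = comp (comp f g) h;
  sm_unit_ob : isob (munit C);
  sm_tens_ob : forall X Y : ob C, isob X -> isob Y -> isob (tens X Y);
  sm_tensm : forall f g : ar C, isar f -> isar g ->
      hom C (tensm f g) (tens (dom f) (dom g)) (tens (cod f) (cod g));
  sm_tens_id : forall X Y : ob C, isob X -> isob Y ->
      tensm (idm X) (idm Y) = idm (tens X Y);
  sm_interchange : forall f f' g g' : ar C, isar f -> isar f' -> isar g -> isar g' ->
      dom f = cod f' -> dom g = cod g' ->
      tensm (comp f f') (comp g g') = comp (tensm f g) (tensm f' g');
  sm_assoc_ob : forall X Y Z : ob C, isob X -> isob Y -> isob Z ->
      tens X (tens Y Z) = tens (tens X Y) Z;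
  sm_lunit_ob : forall X : ob C, isob X -> tens (munit C) X = X;
  sm_runit_ob : forall X : ob C, isob X -> tens X (munit C) = X;
  sm_assoc_ar : forall f g h : ar C, isar f -> isar g -> isar h ->
      tensm f (tensm g h) = tensm (tensm f g) h;
  sm_lunit_ar : forall f : ar C, isar f -> tensm (idm (munit C)) f = f;
  sm_runit_ar : forall f : ar C, isar f -> tensm f (idm (munit C)) = f }.

Definition is_inverse (C : MonCat) (f g : ar C) : Prop :=
  hom C g (cod f) (dom f) /\ comp g f = idm (dom f) /\ comp f g = idm (cod f).

Definition is_iso (C : MonCat) (f : ar C) : Prop :=
  isar f /\ exists g, is_inverse C f g.

(* the inverse of an isomorphism (chosen classically; unique in a category) *)
Definition inv (C : MonCat) (f : ar C) : ar C :=
  match excluded_middle_informative (exists g, is_inverse C f g) with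
  | left H => proj1_sig (constructive_indefinite_description _ H)
  | right _ => f
  end.

Record CoFun (C D : MonCat) := {
  cfo : ob C -> ob D;
  cfa : ar C -> ar D;
  cf2 : ob C -> ob C -> ar D;   (* F^2(X,Y) : F(X (x) Y) -> FX (x) FY *)
  cf0 : ar D }.                 (* F^0 : F 1 -> 1 *)

Definition is_functor (C D : MonCat) (F : CoFun C D) : Prop :=
  (forall X, isob X -> isob (cfo F X)) /\
  (forall f, isar f -> hom D (cfa F f) (cfo F (dom f)) (cfo F (cod f))) /\
  (forall X, isob X -> cfa F (idm X) = idm (cfo F X)) /\
  (forall f g, isar f -> isar g -> dom f = cod g ->
      cfa F (comp f g) = comp (cfa F f) (cfa F g)).

Definition is_comonoidal (C D : MonCat) (F : CoFun C D) : Prop :=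
  is_functor F /\
  (forall X Y, isob X -> isob Y ->
      hom D (cf2 F X Y) (cfo F (tens X Y)) (tens (cfo F X) (cfo F Y))) /\
  hom D (cf0 F) (cfo F (munit C)) (munit D) /\
  (forall f g, isar f -> isar g ->
      comp (cf2 F (cod f) (cod g)) (cfa F (tensm f g))
      = comp (tensm (cfa F f) (cfa F g)) (cf2 F (dom f) (dom g))) /\
  (forall X Y Z, isob X -> isob Y -> isob Z ->
      comp (tensm (cf2 F X Y) (idm (cfo F Z))) (cf2 F (tens X Y) Z)
      = comp (tensm (idm (cfo F X)) (cf2 F Y Z)) (cf2 F X (tens Y Z))) /\
  (forall X, isob X ->
      comp (tensm (idm (cfo F X)) (cf0 F)) (cf2 F X (munit C)) = idm (cfo F X) /\
      comp (tensm (cf0 F) (idm (cfo F X))) (cf2 F (munit C) X) = idm (cfo F X)).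

Definition is_strong_comonoidal (C D : MonCat) (F : CoFun C D) : Prop :=
  is_comonoidal F /\
  (forall X Y, isob X -> isob Y -> is_iso D (cf2 F X Y)) /\
  is_iso D (cf0 F).

Definition cf_comp (C D E : MonCat) (F : CoFun C D) (K : CoFun D E) : CoFun C E :=
  {| cfo := fun X => cfo K (cfo F X);
     cfa := fun f => cfa K (cfa F f);
     cf2 := fun X Y => comp (cf2 K (cfo F X) (cfo F Y)) (cfa K (cf2 F X Y));
     cf0 := comp (cf0 K) (cfa K (cf0 F)) |}.

Definition is_comonoidal_nat (C D : MonCat) (F K : CoFun C D)
    (alpha : ob C -> ar D) : Prop :=
  (forall X, isob X -> hom D (alpha X) (cfo F X) (cfo K X)) /\
  (forall f, isar f -> comp (alpha (cod f)) (cfa F f) = comp (cfa K f) (alpha (dom f))) /\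
  (forall X Y, isob X -> isob Y ->
      comp (tensm (alpha X) (alpha Y)) (cf2 F X Y) = comp (cf2 K X Y) (alpha (tens X Y))) /\
  comp (cf0 K) (alpha (munit C)) = cf0 F.

Record ActData (D : MonCat) (G : Grp) := {
  ac : G -> CoFun D D;
  acc : G -> G -> ob D -> ar D }.       (* phi_{g,h,X} : phi_g phi_h X -> phi_{gh} X *)

Definition is_action (D : MonCat) (G : Grp) (A : ActData D G) : Prop :=
  (forall g, is_comonoidal (ac A g)) /\
  (forall X, isob X -> cfo (ac A gone) X = X) /\
  (forall f, isar f -> cfa (ac A gone) f = f) /\
  (forall X Y, isob X -> isob Y -> cf2 (ac A gone) X Y = idm (tens X Y)) /\
  cf0 (ac A gone) = idm (munit D) /\
  (forall g h, is_comonoidal_nat (cf_comp (ac A h) (ac A g)) (ac A (gmul g h)) (acc A g h)) /\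
  (forall g h X, isob X -> is_iso D (acc A g h X)) /\
  (forall g h k X, isob X ->
      comp (acc A (gmul g h) k X) (acc A g h (cfo (ac A k) X))
      = comp (acc A g (gmul h k) X) (cfa (ac A g) (acc A h k X))) /\
  (forall g X, isob X ->
      acc A g gone X = idm (cfo (ac A g) X) /\ acc A gone g X = idm (cfo (ac A g) X)).

Definition is_Ggraded (D : MonCat) (G : Grp) (deg : ob D -> G) : Prop :=
  (forall f, isar f -> deg (dom f) = deg (cod f)) /\
  deg (munit D) = gone /\
  (forall X Y, isob X -> isob Y -> deg (tens X Y) = gmul (deg X) (deg Y)).

Definition is_Gcrossed (D : MonCat) (G : Grp) (deg : ob D -> G) (psi : ActData D G) : Prop :=
  @is_Ggraded D G deg /\ @is_action D G psi /\
  (forall g X, isob X -> deg (cfo (ac psi g) X) = gmul (gmul g (deg X)) (ginv g)).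

Definition is_Gbraiding (D : MonCat) (G : Grp) (deg : ob D -> G) (psi : ActData D G)
    (c : ob D -> ob D -> ar D) : Prop :=
  let po g X := cfo (ac psi g) X in
  let pa g f := cfa (ac psi g) f in
  let p2 g X Y := cf2 (ac psi g) X Y in
  let pc g h X := acc psi g h X in
  (forall X Y, isob X -> isob Y ->
      hom D (c X Y) (tens X Y) (tens (po (deg X) Y) X) /\ is_iso D (c X Y)) /\
  (forall f g, isar f -> isar g ->
      comp (tensm (pa (deg (dom f)) g) f) (c (dom f) (dom g))
      = comp (c (cod f) (cod g)) (tensm f g)) /\
  (forall X Y Z, isob X -> isob Y -> isob Z ->
      c (tens X Y) Z
      = comp (tensm (pc (deg X) (deg Y) Z) (idm (tens X Y)))
          (comp (tensm (c X (po (deg Y) Z)) (idm Y)) (tensm (idm X) (c Y Z)))) /\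
  (forall X Y Z, isob X -> isob Y -> isob Z ->
      comp (tensm (p2 (deg X) Y Z) (idm X)) (c X (tens Y Z))
      = comp (tensm (idm (po (deg X) Y)) (c X Z)) (tensm (c X Y) (idm Z))) /\
  (forall k X Y, isob X -> isob Y ->
      comp (tensm (pc k (deg X) Y) (idm (po k X)))
        (comp (p2 k (po (deg X) Y) X) (pa k (c X Y)))
      = comp (tensm (pc (gmul (gmul k (deg X)) (ginv k)) k Y) (idm (po k X)))
          (comp (c (po k X) (po k Y)) (p2 k X Y))).

Section ZG.
Variables (C : MonCat) (G : Grp) (A : ActData C G).

Definition phio (g : G) (X : ob C) := cfo (ac A g) X.
Definition phia (g : G) (f : ar C) := cfa (ac A g) f.
Definition phi2 (g : G) (X Y : ob C) := cf2 (ac A g) X Y.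
Definition phi0 (g : G) := cf0 (ac A g).
Definition phic (g h : G) (X : ob C) := acc A g h X.
Definition phic3 (g h k : G) (V : ob C) :=
  comp (phic (gmul g h) k V) (phic g h (phio k V)).
(* g.u for u : A1 (x) A2 -> B1 (x) B2 *)
Definition dotact (g : G) (u : ar C) (A1 A2 B1 B2 : ob C) :=
  comp (phi2 g B1 B2) (comp (phia g u) (inv C (phi2 g A1 A2))).

Definition is_half_braiding (F : CoFun C C) (X : ob C) (gam : ob C -> ar C) : Prop :=
  (forall V, isob V -> hom C (gam V) (tens X V) (tens (cfo F V) X) /\ is_iso C (gam V)) /\
  (forall f, isar f ->
      comp (tensm (cfa F f) (idm X)) (gam (dom f)) = comp (gam (cod f)) (tensm (idm X) f)) /\
  (forall V W, isob V -> isob W ->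
      comp (tensm (cf2 F V W) (idm X)) (gam (tens V W))
      = comp (tensm (idm (cfo F V)) (gam W)) (tensm (gam V) (idm W))) /\
  comp (tensm (cf0 F) (idm X)) (gam (munit C)) = idm X.

Record ZOb := { zdeg : G; zob : ob C; zhb : ob C -> ar C }.
Record ZAr := { zsrc : ZOb; ztgt : ZOb; zmor : ar C }.

Definition Z_isob (X : ZOb) : Prop :=
  isob (zob X) /\ is_half_braiding (ac A (zdeg X)) (zob X) (zhb X).

Definition Z_isar (a : ZAr) : Prop :=
  Z_isob (zsrc a) /\ Z_isob (ztgt a) /\ zdeg (zsrc a) = zdeg (ztgt a) /\
  hom C (zmor a) (zob (zsrc a)) (zob (ztgt a)) /\
  (forall V, isob V ->
     comp (tensm (idm (phio (zdeg (zsrc a)) V)) (zmor a)) (zhb (zsrc a) V)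
     = comp (zhb (ztgt a) V) (tensm (zmor a) (idm V))).

Definition Z_tens (X Y : ZOb) : ZOb :=
  {| zdeg := gmul (zdeg X) (zdeg Y);
     zob := tens (zob X) (zob Y);
     zhb := fun V =>
       comp (tensm (phic (zdeg X) (zdeg Y) V) (idm (tens (zob X) (zob Y))))
         (comp (tensm (zhb X (phio (zdeg Y) V)) (idm (zob Y)))
               (tensm (idm (zob X)) (zhb Y V))) |}.

Definition Z_unit : ZOb := {| zdeg := gone; zob := munit C; zhb := fun V => idm V |}.

Definition ZG : MonCat :=
  {| ob := ZOb; ar := ZAr; isob := Z_isob; isar := Z_isar;
     dom := zsrc; cod := ztgt;
     idm := fun X => {| zsrc := X; ztgt := X; zmor := idm (zob X) |};
     comp := fun a b => {| zsrc := zsrc b; ztgt := ztgt a; zmor := comp (zmor a) (zmor b) |};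
     munit := Z_unit;
     tens := Z_tens;
     tensm := fun a b => {| zsrc := Z_tens (zsrc a) (zsrc b);
                            ztgt := Z_tens (ztgt a) (ztgt b);
                            zmor := tensm (zmor a) (zmor b) |} |}.

Definition Phi_o (l : G) (X : ZOb) : ZOb :=
  let h := zdeg X in
  {| zdeg := gmul (gmul l h) (ginv l);
     zob := phio l (zob X);
     zhb := fun V =>
       let W := phio (ginv l) V in
       comp (tensm (phic3 l h (ginv l) V) (idm (phio l (zob X))))
         (comp (dotact l (zhb X W) (zob X) W (phio h W) (zob X))
               (tensm (idm (phio l (zob X))) (inv C (phic l (ginv l) V)))) |}.

Definition Phi_a (l : G) (a : ZAr) : ZAr :=
  {| zsrc := Phi_o l (zsrc a); ztgt := Phi_o l (ztgt a); zmor := phia l (zmor a) |}.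

Definition PhiFun (g : G) : CoFun ZG ZG :=
  @Build_CoFun ZG ZG (Phi_o g) (Phi_a g)
    (fun X Y => {| zsrc := Phi_o g (Z_tens X Y);
                   ztgt := Z_tens (Phi_o g X) (Phi_o g Y);
                   zmor := phi2 g (zob X) (zob Y) |})
    {| zsrc := Phi_o g Z_unit; ztgt := Z_unit; zmor := phi0 g |}.

Definition PhiZ : ActData ZG G :=
  @Build_ActData ZG G PhiFun
    (fun g h X => {| zsrc := Phi_o g (Phi_o h X);
                     ztgt := Phi_o (gmul g h) X;
                     zmor := phic g h (zob X) |}).

Definition cZ (X Y : ZOb) : ZAr :=
  {| zsrc := Z_tens X Y; ztgt := Z_tens (Phi_o (zdeg X) Y) X; zmor := zhb X (zob Y) |}.

End ZG.

(* Main.v *)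
(** Each [phi_l] is strong comonoidal, because [phi_(l^-1)] is a comonoidal quasi-inverse. The
    half-braiding of [Phi_l X] is then characterised, among natural families, by the equation
      [(phi_{lhl^-1,l,V} (x) lX) o gamma_{lX,lV} o phi_l^2(X,V)
       = (phi_{l,h,V} (x) lX) o phi_l^2(hV,X) o phi_l(gamma_{X,V})],
    since every object is isomorphic to some [phi_l V]; it is also axiom (iii) of a G-braiding.
    Every identity about the half-braiding of [Phi_l X] is therefore checked on objects [phi_l V],
    where it follows from this equation, the coherence of [phi] and the identity for [gamma_X].
    Planar rewriting steps are decided by reflection: a diagram is cut into layers containing one
    generator each, and the layers are sorted by the interchange law. *)
From Stdlib Require Import List Arith FunctionalExtensionality ClassicalEpsilon.
Require Import Defs.
Import ListNotations.

Set Implicit Arguments.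

(** * Deciding equality of string diagrams *)

(** The definition of [Phi_o] involves the inverse of [phi_l^2], although [phi_l] is only assumed
    comonoidal and [inv] returns its argument on a non-isomorphism. Strength must therefore be known
    before anything can be said about [Phi_l]. The characterising equation is free of inverses:
    composing a claim on either side with compositors and maps [phi_l^2], which can be cancelled
    again, brings both sides to a form where it applies. Degrees such as [(lhl^-1)l] and [lh], and
    iterated tensor products, agree only by provable equations. Arrows are untyped and [hom] is a
    predicate, so such equations are rewritten without any transport. The decision procedure knows
    the strict monoidal axioms and nothing else: inverses, compositors and values of [phi_g] are
    opaque generators, and their identities are applied by hand between two planar steps. It runs in
    [C] alone; an equation in [ZG A] is first split into equations of endpoints and of underlying
    arrows. *)

Inductive oexp := OUnit | OAtom (i : nat) | OTens (a b : oexp).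
Inductive mexp := MId (o : oexp) | MGen (i : nat) | MComp (a b : mexp) | MTens (a b : mexp).

Fixpoint flatten (o : oexp) : list nat :=
  match o with
  | OUnit => []
  | OAtom i => [i]
  | OTens a b => flatten a ++ flatten b
  end.

(* [(L, i, R)] stands for generator [i] with wires [L] to its left and [R] to its right. *)
Definition layer := (list nat * nat * list nat)%type.

Fixpoint leqb (l l' : list nat) : bool :=
  match l, l' with
  | [], [] => true
  | x :: l, y :: l' => andb (x =? y) (leqb l l')
  | _, _ => false
  end.

Lemma leqb_eq l l' : leqb l l' = true -> l = l'.
Proof.
revert l'; induction l as [|x l IH]; intros [|y l']; simpl; try easy.
intros H; apply andb_prop in H as [H1 H2].
now rewrite (proj1 (Nat.eqb_eq _ _) H1), (IH _ H2).
Qed.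

Fixpoint strip (p l : list nat) : option (list nat) :=
  match p, l with
  | [], _ => Some l
  | x :: p, y :: l => if x =? y then strip p l else None
  | _, _ => None
  end.

Lemma strip_eq p l r : strip p l = Some r -> l = p ++ r.
Proof.
revert l; induction p as [|x p IH]; intros [|y l]; simpl; try congruence.
destruct (Nat.eqb_spec x y) as [->|]; try congruence.
now intros H; rewrite (IH _ H).
Qed.

Section Normalisation.
Variable ty : list (oexp * oexp).

(** The default type for an index out of range has the unit on both sides, matching the default
    arrow [idm (munit C)] in [garr]. Every index is thus well typed and no bound has to be
    checked. *)
Definition gsrc (i : nat) : list nat := flatten (fst (nth i ty (OUnit, OUnit))).
Definition gtgt (i : nat) : list nat := flatten (snd (nth i ty (OUnit, OUnit))).

Fixpoint layers (e : mexp) : option (list nat * list nat * list layer) :=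
  match e with
  | MId o => Some (flatten o, flatten o, [])
  | MGen i => Some (gsrc i, gtgt i, [([], i, [])])
  | MComp a b =>
      match layers a, layers b with
      | Some (sa, ta, la), Some (sb, tb, lb) =>
          if leqb sa tb then Some (sb, ta, lb ++ la) else None
      | _, _ => None
      end
  | MTens a b =>
      match layers a, layers b with
      | Some (sa, ta, la), Some (sb, tb, lb) =>
          Some (sa ++ sb, ta ++ tb,
                map (fun x : layer => let '(L, i, R) := x in (L, i, R ++ sb)) la
                ++ map (fun x : layer => let '(L, i, R) := x in (ta ++ L, i, R)) lb)
      | _, _ => None
      end
  end.

(* A layer acting strictly to the left of its predecessor is moved before it. *)
Definition exchange (x y : layer) : option (layer * layer) :=
  let '(L1, i, R1) := x in
  let '(L2, j, R2) := y in
  match strip (L2 ++ gsrc j) L1 with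
  | Some M =>
      if leqb R2 (M ++ gtgt i ++ R1)
      then Some ((L2, j, M ++ gsrc i ++ R1), (L2 ++ gtgt j ++ M, i, R1))
      else None
  | None => None
  end.

Fixpoint insert (x : layer) (ls : list layer) : list layer :=
  match ls with
  | [] => [x]
  | y :: ls' =>
      match exchange x y with
      | Some (y', x') => y' :: insert x' ls'
      | None => x :: ls
      end
  end.

Definition pass (ls : list layer) : list layer := fold_right insert [] ls.

Fixpoint passes (n : nat) (ls : list layer) : list layer :=
  match n with
  | 0 => ls
  | S n => passes n (pass ls)
  end.

Fixpoint layers_eqb (l l' : list layer) : bool :=
  match l, l' with
  | [], [] => true
  | (L, i, R) :: l, (L', i', R') :: l' =>
      andb (andb (leqb L L') (i =? i')) (andb (leqb R R') (layers_eqb l l'))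
  | _, _ => false
  end.

Lemma layers_eqb_eq l l' : layers_eqb l l' = true -> l = l'.
Proof.
revert l'; induction l as [|[[L i] R] l IH]; intros [|[[L' i'] R'] l']; simpl; try easy.
intros H; apply andb_prop in H as [H1 H2].
apply andb_prop in H1 as [H1 H3]; apply andb_prop in H2 as [H2 H4].
now rewrite (leqb_eq _ _ H1), (leqb_eq _ _ H2), (proj1 (Nat.eqb_eq _ _) H3), (IH _ H4).
Qed.

(** Targets are not compared: the source and the layers determine them. The number of passes affects
    only which equalities are recognised, since each single pass is sound. *)
Definition same_diagram (a b : mexp) : bool :=
  match layers a, layers b with
  | Some (sa, _, la), Some (sb, _, lb) =>
      andb (leqb sa sb) (layers_eqb (passes (length la) la) (passes (length lb) lb))
  | _, _ => false
  end.

Definition has_type (a : mexp) (s t : oexp) : bool :=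
  match layers a with
  | Some (sa, ta, _) => andb (leqb sa (flatten s)) (leqb ta (flatten t))
  | None => false
  end.

End Normalisation.

Existing Class hom.
Existing Class is_iso.

(** * Soundness of the decision procedure in a strict monoidal category *)

Section StrictMonoidal.
Variable C : MonCat.
Hypothesis HC : is_strict_monoidal C.
Hypothesis HobC : forall X : ob C, isob X.

Lemma tensoA (X Y Z : ob C) : tens (tens X Y) Z = tens X (tens Y Z).
Proof. symmetry; apply (sm_assoc_ob HC); apply HobC. Qed.
Lemma tenso1l (X : ob C) : tens (munit C) X = X.
Proof. apply (sm_lunit_ob HC), HobC. Qed.
Lemma tenso1r (X : ob C) : tens X (munit C) = X.
Proof. apply (sm_runit_ob HC), HobC. Qed.

Instance hom_idm (X : ob C) : hom C (idm X) X X.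
Proof. apply (sm_idm HC), HobC. Qed.

Instance hom_comp (X Y Z : ob C) f g :
  hom C f Y Z -> hom C g X Y -> hom C (comp f g) X Z.
Proof.
intros (Hf & <- & <-) (Hg & <- & E).
now apply (sm_comp HC).
Qed.

Instance hom_tensm (X Y Z T : ob C) f g :
  hom C f X Y -> hom C g Z T -> hom C (tensm f g) (tens X Z) (tens Y T).
Proof. intros (Hf & <- & <-) (Hg & <- & <-); now apply (sm_tensm HC). Qed.

Lemma compA (X Y Z T : ob C) f g h :
  hom C f Z T -> hom C g Y Z -> hom C h X Y -> comp f (comp g h) = comp (comp f g) h.
Proof.
intros (Hf & ? & ?) (Hg & ? & ?) (Hh & ? & ?).
apply (sm_assoc HC); congruence.
Qed.

Lemma comp1l (X Y : ob C) f : hom C f X Y -> comp (idm Y) f = f.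
Proof. intros (Hf & <- & <-); now apply (sm_idl HC). Qed.
Lemma comp1r (X Y : ob C) f : hom C f X Y -> comp f (idm X) = f.
Proof. intros (Hf & <- & <-); now apply (sm_idr HC). Qed.

Lemma interchange (X Y Z X' Y' Z' : ob C) f f' g g' :
  hom C f Y Z -> hom C f' X Y -> hom C g Y' Z' -> hom C g' X' Y' ->
  tensm (comp f f') (comp g g') = comp (tensm f g) (tensm f' g').
Proof.
intros (Hf & ? & ?) (Hg & ? & ?) (Hh & ? & ?) (Hk & ? & ?).
apply (sm_interchange HC); congruence.
Qed.

Lemma tensmA (X Y Z X' Y' Z' : ob C) f g h :
  hom C f X X' -> hom C g Y Y' -> hom C h Z Z' ->
  tensm f (tensm g h) = tensm (tensm f g) h.
Proof. intros (Hf & _) (Hg & _) (Hh & _); now apply (sm_assoc_ar HC). Qed.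
Lemma tensm1l (X Y : ob C) f : hom C f X Y -> tensm (idm (munit C)) f = f.
Proof. intros (Hf & _); now apply (sm_lunit_ar HC). Qed.
Lemma tensm1r (X Y : ob C) f : hom C f X Y -> tensm f (idm (munit C)) = f.
Proof. intros (Hf & _); now apply (sm_runit_ar HC). Qed.
Lemma tensm_idm (X Y : ob C) : tensm (idm X) (idm Y) = idm (tens X Y).
Proof. apply (sm_tens_id HC); apply HobC. Qed.

(** This is the order fixed by [layers] for [MTens]: the left factor acts first, so its layers are
    whiskered with the source of the right factor, and the later ones with the target of the left
    factor. *)
Lemma tensm_rl (X Y X' Y' : ob C) f g : hom C f X Y -> hom C g X' Y' ->
  tensm f g = comp (tensm (idm Y) g) (tensm f (idm X')).
Proof.
intros Hf Hg; erewrite <- interchange; eauto with typeclass_instances.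
now rewrite (comp1l Hf), (comp1r Hg).
Qed.

Section Soundness.
Variables (obs : list (ob C)) (gens : list (ar C)) (ty : list (oexp * oexp)).

Definition atom (i : nat) : ob C := nth i obs (munit C).
Definition garr (i : nat) : ar C := nth i gens (idm (munit C)).

Fixpoint ointerp (o : oexp) : ob C :=
  match o with
  | OUnit => munit C
  | OAtom i => nth i obs (munit C)
  | OTens a b => tens (ointerp a) (ointerp b)
  end.

Fixpoint linterp (l : list nat) : ob C :=
  match l with
  | [] => munit C
  | i :: l => tens (atom i) (linterp l)
  end.

Fixpoint minterp (e : mexp) : ar C :=
  match e with
  | MId o => idm (ointerp o)
  | MGen i => nth i gens (idm (munit C))
  | MComp a b => comp (minterp a) (minterp b)
  | MTens a b => tensm (minterp a) (minterp b)
  end.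

Fixpoint typed (gs : list (ar C)) (ts : list (oexp * oexp)) : Prop :=
  match gs, ts with
  | [], [] => True
  | g :: gs, t :: ts => hom C g (ointerp (fst t)) (ointerp (snd t)) /\ typed gs ts
  | _, _ => False
  end.

Hypothesis Hty : typed gens ty.

Lemma linterp_app l l' : linterp (l ++ l') = tens (linterp l) (linterp l').
Proof.
induction l as [|i l IH]; simpl; [now rewrite tenso1l|now rewrite IH, tensoA].
Qed.

Lemma linterp_flatten o : linterp (flatten o) = ointerp o.
Proof.
induction o as [|i|a IHa b IHb]; simpl; trivial; [apply tenso1r|].
now rewrite linterp_app, IHa, IHb.
Qed.

Instance hom_garr i : hom C (garr i) (linterp (gsrc ty i)) (linterp (gtgt ty i)).
Proof.
unfold gsrc, gtgt, garr; rewrite !linterp_flatten.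
revert ty i Hty; induction gens as [|g gs IH]; intros [|t ts] [|i]; simpl;
  try contradiction; try (intros; apply hom_idm); intros [H1 H2]; trivial.
now apply IH.
Qed.

Definition whisker (L : list nat) (f : ar C) (R : list nat) : ar C :=
  tensm (idm (linterp L)) (tensm f (idm (linterp R))).

Instance hom_whisker L R s t f : hom C f (linterp s) (linterp t) ->
  hom C (whisker L f R) (linterp (L ++ s ++ R)) (linterp (L ++ t ++ R)).
Proof.
intros H; unfold whisker; rewrite !linterp_app; eauto with typeclass_instances.
Qed.

Fixpoint dinterp (s : list nat) (ls : list layer) : ar C :=
  match ls with
  | [] => idm (linterp s)
  | (L, i, R) :: ls =>
      comp (dinterp (L ++ gtgt ty i ++ R) ls) (whisker L (garr i) R)
  end.

Fixpoint chain (s : list nat) (ls : list layer) (t : list nat) : Prop :=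
  match ls with
  | [] => s = t
  | (L, i, R) :: ls => s = L ++ gsrc ty i ++ R /\ chain (L ++ gtgt ty i ++ R) ls t
  end.

Instance hom_dinterp ls : forall s t, chain s ls t ->
  hom C (dinterp s ls) (linterp s) (linterp t).
Proof.
induction ls as [|[[L i] R] ls IH]; simpl.
- intros s t <-; apply hom_idm.
- intros s t [-> H]; eapply hom_comp; [now apply IH|apply hom_whisker, hom_garr].
Qed.

Lemma chain_app ls ls' : forall s m t, chain s ls m -> chain m ls' t -> chain s (ls ++ ls') t.
Proof.
induction ls as [|[[L i] R] ls IH]; simpl; [now intros; subst|].
intros s m t [-> H] H'; split; trivial; now apply IH with m.
Qed.

Lemma dinterp_app ls ls' : forall s m t, chain s ls m -> chain m ls' t ->
  dinterp s (ls ++ ls') = comp (dinterp m ls') (dinterp s ls).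
Proof.
induction ls as [|[[L i] R] ls IH]; simpl; intros s m t H H'.
- subst; symmetry; eapply comp1r, hom_dinterp, H'.
- destruct H as [-> H]; rewrite (IH _ m t H H').
  symmetry; eapply compA; [eapply hom_dinterp, H'|eapply hom_dinterp, H|].
  apply hom_whisker, hom_garr.
Qed.

Lemma whisker_r L f R T s t : hom C f (linterp s) (linterp t) ->
  whisker L f (R ++ T) = tensm (whisker L f R) (idm (linterp T)).
Proof.
intros H; unfold whisker; rewrite linterp_app, <- tensm_idm.
erewrite <- tensmA; eauto with typeclass_instances.
f_equal; eapply tensmA; eauto with typeclass_instances.
Qed.

Lemma whisker_l L f R T s t : hom C f (linterp s) (linterp t) ->
  whisker (T ++ L) f R = tensm (idm (linterp T)) (whisker L f R).
Proof.
intros H; unfold whisker; rewrite linterp_app, <- tensm_idm.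
symmetry; eapply tensmA; eauto with typeclass_instances.
Qed.

Lemma rwhisker_sound T ls : forall s t, chain s ls t ->
  let ls' := map (fun x : layer => let '(L, i, R) := x in (L, i, R ++ T)) ls in
  chain (s ++ T) ls' (t ++ T) /\
  dinterp (s ++ T) ls' = tensm (dinterp s ls) (idm (linterp T)).
Proof.
induction ls as [|[[L i] R] ls IH]; simpl; intros s t H.
- subst; split; trivial; now rewrite linterp_app, tensm_idm.
- destruct H as [-> H]; destruct (IH _ _ H) as [H1 H2].
  rewrite <- !app_assoc in *; split; [now split|].
  rewrite H2; erewrite whisker_r by apply hom_garr.
  erewrite <- interchange; [|now apply hom_dinterp, H|apply hom_whisker, hom_garr
    |apply hom_idm|apply hom_idm].
  f_equal; eapply comp1l, hom_idm.
Qed.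

Lemma lwhisker_sound T ls : forall s t, chain s ls t ->
  let ls' := map (fun x : layer => let '(L, i, R) := x in (T ++ L, i, R)) ls in
  chain (T ++ s) ls' (T ++ t) /\
  dinterp (T ++ s) ls' = tensm (idm (linterp T)) (dinterp s ls).
Proof.
induction ls as [|[[L i] R] ls IH]; simpl; intros s t H.
- subst; split; trivial; now rewrite linterp_app, tensm_idm.
- destruct H as [-> H]; destruct (IH _ _ H) as [H1 H2].
  rewrite <- !app_assoc in *; split; [now split|].
  rewrite H2; erewrite whisker_l by apply hom_garr.
  erewrite <- interchange; [|apply hom_idm|apply hom_idm
     |now apply hom_dinterp, H|apply hom_whisker, hom_garr].
  f_equal; eapply comp1l, hom_idm.
Qed.

Lemma layers_sound e : forall s t ls, layers ty e = Some (s, t, ls) ->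
  chain s ls t /\ minterp e = dinterp s ls.
Proof.
induction e as [o|i|a IHa b IHb|a IHa b IHb]; simpl; intros s t ls.
- intros [= <- <- <-]; simpl; split; trivial; now rewrite linterp_flatten.
- intros [= <- <- <-]; simpl; rewrite !app_nil_r; repeat split.
  unfold whisker; simpl.
  change (nth i gens (idm (munit C))) with (garr i).
  assert (H := hom_garr i).
  erewrite tensm1r, tensm1l by eassumption.
  symmetry; eapply comp1l, hom_garr.
- destruct (layers ty a) as [[[sa ta] la]|]; try discriminate.
  destruct (layers ty b) as [[[sb tb] lb]|]; try discriminate.
  destruct (leqb sa tb) eqn:E; try discriminate.
  apply leqb_eq in E as ->; intros [= <- <- <-].
  destruct (IHa _ _ _ eq_refl) as [Ha ->]; destruct (IHb _ _ _ eq_refl) as [Hb ->].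
  split; [now apply chain_app with tb|].
  symmetry; now apply dinterp_app with ta.
- destruct (layers ty a) as [[[sa ta] la]|]; try discriminate.
  destruct (layers ty b) as [[[sb tb] lb]|]; try discriminate.
  intros [= <- <- <-].
  destruct (IHa _ _ _ eq_refl) as [Ha ->]; destruct (IHb _ _ _ eq_refl) as [Hb ->].
  destruct (rwhisker_sound sb la _ _ Ha) as [H1 H2].
  destruct (lwhisker_sound ta lb _ _ Hb) as [H3 H4].
  split; [now apply chain_app with (ta ++ sb)|].
  refine (eq_trans _ (eq_sym (dinterp_app _ _ _ _ _ H1 H3))); rewrite H2, H4.
  exact (tensm_rl (hom_dinterp _ _ _ Ha) (hom_dinterp _ _ _ Hb)).
Qed.

Lemma exchange_sound x y x' y' s t ls :
  exchange ty x y = Some (y', x') -> chain s (x :: y :: ls) t ->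
  chain s (y' :: x' :: ls) t /\ dinterp s (x :: y :: ls) = dinterp s (y' :: x' :: ls).
Proof.
destruct x as [[L1 i] R1], y as [[L2 j] R2]; unfold exchange.
destruct (strip (L2 ++ gsrc ty j) L1) as [M|] eqn:EL; try discriminate.
apply strip_eq in EL as ->.
destruct (leqb R2 (M ++ gtgt ty i ++ R1)) eqn:ER; try discriminate.
apply leqb_eq in ER as ->.
intros [= <- <-]; simpl; rewrite <- !app_assoc.
intros (-> & H1 & H2); repeat split; trivial.
assert (Hi := hom_garr i); assert (Hj := hom_garr j).
assert (Ti : forall L, hom C (whisker (L2 ++ L ++ M) (garr i) R1)
    (linterp (L2 ++ L ++ M ++ gsrc ty i ++ R1))
    (linterp (L2 ++ L ++ M ++ gtgt ty i ++ R1))).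
{ intros L; assert (H := hom_whisker (L2 ++ L ++ M) R1 _ _ Hi).
  now rewrite <- !app_assoc in H. }
(* Once [L2] is split off, generator [j] and the whiskered generator [i] stand in different factors
   of a tensor product, and both sides reduce to the same tensor by the interchange law. *)
assert (Q : comp (whisker L2 (garr j) (M ++ gtgt ty i ++ R1))
                 (whisker (L2 ++ gsrc ty j ++ M) (garr i) R1)
          = comp (whisker (L2 ++ gtgt ty j ++ M) (garr i) R1)
                 (whisker L2 (garr j) (M ++ gsrc ty i ++ R1))).
{ rewrite !(fun T => whisker_l (T ++ M) R1 L2 _ _ Hi), !(fun T => whisker_l M R1 T _ _ Hi).
  unfold whisker at 1 4.
  erewrite <- !interchange by eauto with typeclass_instances.
  f_equal.
  rewrite !linterp_app.
  set (w := whisker M (garr i) R1).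
  assert (Hw : hom C w (tens (linterp M) (tens (linterp (gsrc ty i)) (linterp R1)))
     (tens (linterp M) (tens (linterp (gtgt ty i)) (linterp R1)))).
  { rewrite <- !linterp_app; apply hom_whisker, Hi. }
  now rewrite (comp1r Hj), (comp1l Hj), (comp1r Hw), (comp1l Hw). }
erewrite <- compA; [|now apply hom_dinterp, H2|apply hom_whisker, Hj|apply Ti].
rewrite Q; eapply compA; [now apply hom_dinterp, H2|apply Ti|apply hom_whisker, Hj].
Qed.

Lemma insert_sound ls : forall x s t, chain s (x :: ls) t ->
  chain s (insert ty x ls) t /\ dinterp s (x :: ls) = dinterp s (insert ty x ls).
Proof.
induction ls as [|y ls IH]; intros x s t H; [easy|].
simpl insert; destruct (exchange ty x y) as [[y' x']|] eqn:E; [|easy].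
destruct (exchange_sound _ _ _ _ _ E H) as [H1 ->].
destruct y' as [[L i] R]; destruct H1 as [-> H1].
destruct (IH _ _ _ H1) as [H2 H3].
split; [now split|].
simpl dinterp at 2; now rewrite <- H3.
Qed.

Lemma pass_sound ls : forall s t, chain s ls t ->
  chain s (pass ty ls) t /\ dinterp s ls = dinterp s (pass ty ls).
Proof.
induction ls as [|[[L i] R] ls IH]; intros s t H; [easy|].
destruct H as [-> H]; destruct (IH _ _ H) as [H1 H2]; simpl pass.
destruct (insert_sound (pass ty ls) (L, i, R) (L ++ gsrc ty i ++ R) t)
  as [H3 H4]; [now split|].
split; trivial; rewrite <- H4; simpl; now rewrite H2.
Qed.

Lemma passes_sound n : forall ls s t, chain s ls t ->
  chain s (passes ty n ls) t /\ dinterp s ls = dinterp s (passes ty n ls).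
Proof.
induction n as [|n IH]; intros ls s t H; [easy|]; simpl.
destruct (pass_sound _ _ _ H) as [H1 ->]; now apply IH.
Qed.

Lemma same_diagram_sound a b : same_diagram ty a b = true -> minterp a = minterp b.
Proof.
unfold same_diagram.
destruct (layers ty a) as [[[sa ta] la]|] eqn:Ea; try discriminate.
destruct (layers ty b) as [[[sb tb] lb]|] eqn:Eb; try discriminate.
intros H; apply andb_prop in H as [Es El].
apply leqb_eq in Es as ->; apply layers_eqb_eq in El.
destruct (layers_sound _ Ea) as [Ha ->]; destruct (layers_sound _ Eb) as [Hb ->].
destruct (passes_sound (length la) _ _ _ Ha) as [_ ->].
destruct (passes_sound (length lb) _ _ _ Hb) as [_ ->].
now rewrite El.
Qed.

Lemma has_type_sound a s t :
  has_type ty a s t = true -> hom C (minterp a) (ointerp s) (ointerp t).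
Proof.
unfold has_type; destruct (layers ty a) as [[[sa ta] la]|] eqn:Ea; try discriminate.
intros H; apply andb_prop in H as [Es Et].
apply leqb_eq in Es as ->; apply leqb_eq in Et as ->.
destruct (layers_sound _ Ea) as [Ha ->].
rewrite <- !linterp_flatten; now apply hom_dinterp.
Qed.

End Soundness.
End StrictMonoidal.

(** * Reification of arrows and of their types *)

Ltac position x l :=
  lazymatch l with
  | x :: _ => constr:(0)
  | _ :: ?l => let n := position x l in constr:(S n)
  end.

Ltac adjoin x l :=
  lazymatch l with
  | nil => constr:(x :: nil)
  | x :: _ => l
  | ?y :: ?l' => let r := adjoin x l' in constr:(y :: r)
  end.

Ltac atoms o l :=
  lazymatch o with
  | munit _ => l
  | tens ?a ?b => let l := atoms a l in atoms b l
  | _ => adjoin o l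
  end.

Ltac idm_atoms e l :=
  lazymatch e with
  | comp ?a ?b => let l := idm_atoms a l in idm_atoms b l
  | tensm ?a ?b => let l := idm_atoms a l in idm_atoms b l
  | idm ?o => atoms o l
  | _ => l
  end.

Ltac generators e l :=
  lazymatch e with
  | comp ?a ?b => let l := generators a l in generators b l
  | tensm ?a ?b => let l := generators a l in generators b l
  | idm _ => l
  | _ => adjoin e l
  end.

(* Atoms are compared syntactically, so the objects occurring in inferred types are first put
   in normal form (strict associativity and unit laws, group laws) by the base [diagram]. *)
Ltac typings C l :=
  lazymatch l with
  | nil => constr:(tt)
  | ?g :: ?l =>
      let H := constr:(ltac:(let H := fresh in
        pose proof (_ : hom C g _ _) as H; autorewrite with diagram in H; exact H)) in
      let r := typings C l in constr:((H, r))
  end.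

Ltac typing_atoms p l :=
  lazymatch p with
  | tt => l
  | (?H, ?p) =>
      lazymatch type of H with
      | hom _ _ ?X ?Y =>
          let l := atoms X l in let l := atoms Y l in typing_atoms p l
      end
  end.

Ltac reify_ob obs o :=
  lazymatch o with
  | munit _ => constr:(OUnit)
  | tens ?a ?b =>
      let a := reify_ob obs a in let b := reify_ob obs b in constr:(OTens a b)
  | _ => let i := position o obs in constr:(OAtom i)
  end.

Ltac reify_ar obs gens e :=
  lazymatch e with
  | comp ?a ?b =>
      let a := reify_ar obs gens a in let b := reify_ar obs gens b in constr:(MComp a b)
  | tensm ?a ?b =>
      let a := reify_ar obs gens a in let b := reify_ar obs gens b in constr:(MTens a b)
  | idm ?o => let o := reify_ob obs o in constr:(MId o)
  | _ => let i := position e gens in constr:(MGen i)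
  end.

Ltac reify_types obs p :=
  lazymatch p with
  | tt => constr:(@nil (oexp * oexp))
  | (?H, ?p) =>
      lazymatch type of H with
      | hom _ _ ?X ?Y =>
          let X := reify_ob obs X in let Y := reify_ob obs Y in
          let r := reify_types obs p in constr:((X, Y) :: r)
      end
  end.

Ltac typings_proof p :=
  lazymatch p with
  | tt => constr:(I)
  | (?H, ?p) => let r := typings_proof p in constr:(conj H r)
  end.

(** Instance search types the generators only; that composites match is part of the computed boolean
    test. *)
Ltac diagram_eq HC HobC :=
  autorewrite with diagram;
  lazymatch goal with
  | |- @eq (ar ?C) ?a ?b =>
      let gens := generators a (@nil (ar C)) in
      let gens := generators b gens in
      let p := typings C gens in
      let obs := typing_atoms p (@nil (ob C)) in
      let obs := idm_atoms a obs in
      let obs := idm_atoms b obs in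
      let ty := reify_types obs p in
      let pr := typings_proof p in
      let ea := reify_ar obs gens a in
      let eb := reify_ar obs gens b in
      exact (@same_diagram_sound C HC HobC obs gens ty pr ea eb
               (eq_refl true <: same_diagram ty ea eb = true))
  end.

Ltac diagram_type HC HobC :=
  autorewrite with diagram;
  lazymatch goal with
  | |- hom ?C ?a ?X ?Y =>
      let gens := generators a (@nil (ar C)) in
      let p := typings C gens in
      let obs := typing_atoms p (@nil (ob C)) in
      let obs := idm_atoms a obs in
      let obs := atoms X obs in
      let obs := atoms Y obs in
      let ty := reify_types obs p in
      let pr := typings_proof p in
      let ea := reify_ar obs gens a in
      let eX := reify_ob obs X in
      let eY := reify_ob obs Y in
      exact (@has_type_sound C HC HobC obs gens ty pr ea eX eY
               (eq_refl true <: has_type ty ea eX eY = true))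
  end.

Lemma ginv_gone (G : Grp) : @ginv G gone = gone.
Proof. rewrite <- (gmul1l G (ginv gone)); apply gmulVr. Qed.

Lemma gmulK (G : Grp) (x y : G) : gmul (gmul x y) (ginv y) = x.
Proof. now rewrite <- gmulA, gmulVr, gmul1r. Qed.

Lemma gmulKV (G : Grp) (x y : G) : gmul (gmul x (ginv y)) y = x.
Proof. now rewrite <- gmulA, gmulVl, gmul1r. Qed.

Lemma ginvM (G : Grp) (x y : G) : ginv (gmul x y) = gmul (ginv y) (ginv x).
Proof.
rewrite <- (gmul1l G (gmul (ginv y) (ginv x))), <- (gmulVl G (gmul x y)), <- gmulA.
now rewrite (gmulA G (gmul x y)), gmulK, gmulVr, gmul1r.
Qed.

(** * Coherent actions *)

Section CrossedCenter.
Variables (C : MonCat) (G : Grp) (A : ActData C G).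
Hypothesis HC : is_strict_monoidal C.
Hypothesis HobC : forall X : ob C, isob X.
Hypothesis HA : is_action A.

Ltac smc := diagram_eq HC HobC.
Ltac smt := diagram_type HC HobC.
Ltac tc := typeclasses eauto.

Local Existing Instance hom_idm.
Local Existing Instance hom_comp.
Local Existing Instance hom_tensm.
#[local] Hint Extern 0 (is_strict_monoidal _) => exact HC : typeclass_instances.
#[local] Hint Extern 0 (forall X : ob _, isob X) => exact HobC : typeclass_instances.

#[local] Hint Rewrite (tensoA HC HobC) (tenso1l HC HobC) (tenso1r HC HobC)
  gmulA gmul1l gmul1r gmulVl gmulVr gmulK gmulKV ginv_gone ginvM : diagram.

(** * Isomorphisms and their chosen inverses *)

Lemma inv_inverse f : is_iso C f -> is_inverse C f (inv C f).
Proof.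
intros [_ H]; unfold inv.
destruct (excluded_middle_informative _) as [E|N]; [|contradiction].
apply proj2_sig.
Qed.

Local Instance hom_inv f X Y : hom C f X Y -> is_iso C f -> hom C (inv C f) Y X.
Proof. intros (_ & <- & <-) H; apply (inv_inverse H). Qed.

Lemma comp_inv_l f X Y : hom C f X Y -> is_iso C f -> comp (inv C f) f = idm X.
Proof. intros (_ & <- & <-) H; apply (inv_inverse H). Qed.

Lemma comp_inv_r f X Y : hom C f X Y -> is_iso C f -> comp f (inv C f) = idm Y.
Proof. intros (_ & <- & <-) H; apply (inv_inverse H). Qed.

(** The left and right inverses are allowed to be different arrows because in [phi2_iso] and
    [phi0_iso] they arise from unrelated constructions. *)
Lemma iso_intro f X Y l r : hom C f X Y -> hom C l Y X -> hom C r Y X ->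
  comp l f = idm X -> comp f r = idm Y -> is_iso C f.
Proof.
intros Hf Hl Hr El Er; assert (E : l = r).
{ transitivity (comp l (comp f r)); [rewrite Er; smc|].
  transitivity (comp (comp l f) r); [smc|rewrite El; smc]. }
subst r; destruct Hf as (Hf & <- & <-); split; trivial; now exists l.
Qed.

Local Instance iso_idm X : is_iso C (idm X).
Proof. apply (@iso_intro _ X X (idm X) (idm X)); tc || smc. Qed.

Local Instance iso_comp f g X Y Z : hom C f Y Z -> hom C g X Y ->
  is_iso C f -> is_iso C g -> is_iso C (comp f g).
Proof.
intros Hf Hg If Ig.
apply (@iso_intro _ X Z (comp (inv C g) (inv C f)) (comp (inv C g) (inv C f))); try tc.
- transitivity (comp (inv C g) (comp (comp (inv C f) f) g)); [smc|].
  rewrite (comp_inv_l Hf If); transitivity (comp (inv C g) g); [smc|].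
  exact (comp_inv_l Hg Ig).
- transitivity (comp f (comp (comp g (inv C g)) (inv C f))); [smc|].
  rewrite (comp_inv_r Hg Ig); transitivity (comp f (inv C f)); [smc|].
  exact (comp_inv_r Hf If).
Qed.

Local Instance iso_tensm f g X Y Z T : hom C f X Y -> hom C g Z T ->
  is_iso C f -> is_iso C g -> is_iso C (tensm f g).
Proof.
intros Hf Hg If Ig.
apply (@iso_intro _ (tens X Z) (tens Y T) (tensm (inv C f) (inv C g))
  (tensm (inv C f) (inv C g))); try tc.
- transitivity (tensm (comp (inv C f) f) (comp (inv C g) g)); [smc|].
  rewrite (comp_inv_l Hf If), (comp_inv_l Hg Ig); smc.
- transitivity (tensm (comp f (inv C f)) (comp g (inv C g))); [smc|].
  rewrite (comp_inv_r Hf If), (comp_inv_r Hg Ig); smc.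
Qed.

Local Instance iso_inv f X Y : hom C f X Y -> is_iso C f -> is_iso C (inv C f).
Proof.
intros Hf If; apply (@iso_intro _ Y X f f); try tc.
- exact (comp_inv_r Hf If).
- exact (comp_inv_l Hf If).
Qed.

Lemma iso_cancel_r f X Y Z a b : hom C f X Y -> is_iso C f ->
  hom C a Y Z -> hom C b Y Z -> comp a f = comp b f -> a = b.
Proof.
intros Hf If Ha Hb E.
transitivity (comp (comp a f) (inv C f)).
- transitivity (comp a (comp f (inv C f))); [rewrite (comp_inv_r Hf If)|]; smc.
- rewrite E; transitivity (comp b (comp f (inv C f))); [|rewrite (comp_inv_r Hf If)]; smc.
Qed.

Lemma iso_cancel_l f X Y Z a b : hom C f Y Z -> is_iso C f ->
  hom C a X Y -> hom C b X Y -> comp f a = comp f b -> a = b.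
Proof.
intros Hf If Ha Hb E.
transitivity (comp (inv C f) (comp f a)).
- transitivity (comp (comp (inv C f) f) a); [rewrite (comp_inv_l Hf If)|]; smc.
- rewrite E; transitivity (comp (comp (inv C f) f) b); [|rewrite (comp_inv_l Hf If)]; smc.
Qed.

Lemma inv_eq f X Y g : hom C f X Y -> is_iso C f -> hom C g Y X ->
  comp g f = idm X -> inv C f = g.
Proof.
intros Hf If Hg E; apply (iso_cancel_r Hf If (hom_inv Hf If) Hg).
rewrite E; exact (comp_inv_l Hf If).
Qed.

(** * The axioms of the action, restated with [hom] *)

Local Instance phia_hom g f X Y : hom C f X Y -> hom C (phia A g f) (phio A g X) (phio A g Y).
Proof.
intros (Hf & <- & <-); destruct HA as (H & _); destruct (H g) as ((_ & Ha & _) & _).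
now apply Ha.
Qed.

Lemma phia_idm g X : phia A g (idm X) = idm (phio A g X).
Proof.
destruct HA as (H & _); destruct (H g) as ((_ & _ & Ha & _) & _); now apply Ha.
Qed.

Lemma phia_comp g f f' X Y Z : hom C f Y Z -> hom C f' X Y ->
  phia A g (comp f f') = comp (phia A g f) (phia A g f').
Proof.
intros (Hf & ? & ?) (Hf' & ? & ?).
destruct HA as (Hc & _); destruct (Hc g) as ((_ & _ & _ & Ha) & _).
apply Ha; congruence.
Qed.

Local Instance phi2_hom g X Y :
  hom C (phi2 A g X Y) (phio A g (tens X Y)) (tens (phio A g X) (phio A g Y)).
Proof. destruct HA as (H & _); destruct (H g) as (_ & H2 & _); now apply H2. Qed.

Local Instance phi0_hom g : hom C (phi0 A g) (phio A g (munit C)) (munit C).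
Proof. destruct HA as (H & _); destruct (H g) as (_ & _ & H2 & _); now apply H2. Qed.

Lemma phi2_nat g f f' X Y X' Y' : hom C f X Y -> hom C f' X' Y' ->
  comp (phi2 A g Y Y') (phia A g (tensm f f'))
  = comp (tensm (phia A g f) (phia A g f')) (phi2 A g X X').
Proof.
intros (Hf & <- & <-) (Hf' & <- & <-).
destruct HA as (H & _); destruct (H g) as (_ & _ & _ & H2 & _); now apply H2.
Qed.

Lemma phi2_coassoc g X Y Z :
  comp (tensm (phi2 A g X Y) (idm (phio A g Z))) (phi2 A g (tens X Y) Z)
  = comp (tensm (idm (phio A g X)) (phi2 A g Y Z)) (phi2 A g X (tens Y Z)).
Proof.
destruct HA as (H & _); destruct (H g) as (_ & _ & _ & _ & H2 & _); now apply H2.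
Qed.

Lemma phi2_counit_r g X :
  comp (tensm (idm (phio A g X)) (phi0 A g)) (phi2 A g X (munit C)) = idm (phio A g X).
Proof.
destruct HA as (H & _); destruct (H g) as (_ & _ & _ & _ & _ & H2); now apply H2.
Qed.

Lemma phi2_counit_l g X :
  comp (tensm (phi0 A g) (idm (phio A g X))) (phi2 A g (munit C) X) = idm (phio A g X).
Proof.
destruct HA as (H & _); destruct (H g) as (_ & _ & _ & _ & _ & H2); now apply H2.
Qed.

Lemma phio_one X : phio A gone X = X.
Proof. now apply HA. Qed.
Lemma phia_one f X Y : hom C f X Y -> phia A gone f = f.
Proof. intros (Hf & _); now apply HA. Qed.
Lemma phi2_one X Y : phi2 A gone X Y = idm (tens X Y).
Proof. now apply HA. Qed.
Lemma phi0_one : phi0 A gone = idm (munit C).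
Proof. now apply HA. Qed.

Local Instance phic_hom g h X :
  hom C (phic A g h X) (phio A g (phio A h X)) (phio A (gmul g h) X) | 2.
Proof.
destruct HA as (_ & _ & _ & _ & _ & H & _); destruct (H g h) as (H1 & _); now apply H1.
Qed.

Lemma phic_nat g h f X Y : hom C f X Y ->
  comp (phic A g h Y) (phia A g (phia A h f))
  = comp (phia A (gmul g h) f) (phic A g h X).
Proof.
intros (Hf & <- & <-).
destruct HA as (_ & _ & _ & _ & _ & H & _); destruct (H g h) as (_ & H1 & _); now apply H1.
Qed.

Lemma phic_phi2 g h X Y :
  comp (tensm (phic A g h X) (phic A g h Y))
    (comp (phi2 A g (phio A h X) (phio A h Y)) (phia A g (phi2 A h X Y)))
  = comp (phi2 A (gmul g h) X Y) (phic A g h (tens X Y)).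
Proof.
destruct HA as (_ & _ & _ & _ & _ & H & _); destruct (H g h) as (_ & _ & H1 & _); now apply H1.
Qed.

Lemma phic_phi0 g h :
  comp (phi0 A (gmul g h)) (phic A g h (munit C)) = comp (phi0 A g) (phia A g (phi0 A h)).
Proof.
destruct HA as (_ & _ & _ & _ & _ & H & _); destruct (H g h) as (_ & _ & _ & H1); now apply H1.
Qed.

Local Instance phic_iso g h X : is_iso C (phic A g h X).
Proof. destruct HA as (_ & _ & _ & _ & _ & _ & H & _); now apply H. Qed.

Lemma phic_cocycle g h k X :
  comp (phic A (gmul g h) k X) (phic A g h (phio A k X))
  = comp (phic A g (gmul h k) X) (phia A g (phic A h k X)).
Proof. destruct HA as (_ & _ & _ & _ & _ & _ & _ & H & _); now apply H. Qed.

Lemma phic_one_r g X : phic A g gone X = idm (phio A g X).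
Proof. destruct HA as (_ & _ & _ & _ & _ & _ & _ & _ & H); now apply H. Qed.
Lemma phic_one_l g X : phic A gone g X = idm (phio A g X).
Proof. destruct HA as (_ & _ & _ & _ & _ & _ & _ & _ & H); now apply H. Qed.

#[local] Hint Rewrite phio_one : diagram.

(** As [phi_e] is the identity, this compositor ends at [X] itself. Priority 0 lets this simplified
    type win over that of [phic_hom]. *)
Local Instance phicV_hom l X :
  hom C (phic A l (ginv l) X) (phio A l (phio A (ginv l) X)) X | 0.
Proof.
assert (H := phic_hom l (ginv l) X); now rewrite gmulVr, phio_one in H.
Qed.
Local Instance phicVl_hom l X :
  hom C (phic A (ginv l) l X) (phio A (ginv l) (phio A l X)) X | 0.
Proof.
assert (H := phic_hom (ginv l) l X); now rewrite gmulVl, phio_one in H.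
Qed.

Lemma phicV_nat l f X Y : hom C f X Y ->
  comp (phic A l (ginv l) Y) (phia A l (phia A (ginv l) f)) = comp f (phic A l (ginv l) X).
Proof.
intros H; rewrite (phic_nat _ _ H), gmulVr; now rewrite (phia_one H).
Qed.
Lemma phicVl_nat l f X Y : hom C f X Y ->
  comp (phic A (ginv l) l Y) (phia A (ginv l) (phia A l f)) = comp f (phic A (ginv l) l X).
Proof.
intros H; rewrite (phic_nat _ _ H), gmulVl; now rewrite (phia_one H).
Qed.

(* The zigzag identity of the adjoint equivalence between [phi_l] and [phi_(l^-1)]. *)
Lemma phic_zigzag l X : phic A l (ginv l) (phio A l X) = phia A l (phic A (ginv l) l X).
Proof.
assert (H := phic_cocycle l (ginv l) l X).
rewrite gmulVl, gmulVr, phic_one_l, phic_one_r in H.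
transitivity (comp (idm (phio A l X)) (phic A l (ginv l) (phio A l X))); [smc|].
rewrite H; smc.
Qed.

Local Instance phia_iso g f X Y : hom C f X Y -> is_iso C f -> is_iso C (phia A g f).
Proof.
intros Hf If.
apply (@iso_intro _ (phio A g X) (phio A g Y) (phia A g (inv C f)) (phia A g (inv C f)));
  try tc.
- now rewrite <- (phia_comp g (hom_inv Hf If) Hf), (comp_inv_l Hf If), phia_idm.
- now rewrite <- (phia_comp g Hf (hom_inv Hf If)), (comp_inv_r Hf If), phia_idm.
Qed.

(** The arrow [phi_(l^-1)(r)] is a retraction of [phi_(l^-1)(phi_l(f))], which is conjugate to [f]
    under the natural isomorphism with components [phic A (ginv l) l]. Conjugating back gives
    [r']. *)
Lemma phia_reflects_retraction l f X Y r : hom C f X Y ->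
  hom C r (phio A l Y) (phio A l X) -> comp r (phia A l f) = idm (phio A l X) ->
  exists r', hom C r' Y X /\ comp r' f = idm X.
Proof.
intros Hf Hr E.
pose (e := phic A (ginv l) l).
exists (comp (e X) (comp (phia A (ginv l) r) (inv C (e Y)))); split; [tc|].
assert (Q : comp (inv C (e Y)) f = comp (phia A (ginv l) (phia A l f)) (inv C (e X))).
{ apply (@iso_cancel_l (e Y) X (phio A (ginv l) (phio A l Y)) Y); try tc.
  transitivity (comp (comp (e Y) (inv C (e Y))) f); [unfold e; smc|].
  unfold e at 1 2; rewrite (comp_inv_r (phicVl_hom l Y) _).
  transitivity (comp (comp (e Y) (phia A (ginv l) (phia A l f))) (inv C (e X)));
    [|unfold e; smc].
  unfold e at 1; rewrite (phicVl_nat _ Hf).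
  transitivity (comp f (comp (e X) (inv C (e X)))); [|unfold e; smc].
  unfold e; rewrite (comp_inv_r (phicVl_hom l X) _); smc. }
transitivity (comp (e X) (comp (phia A (ginv l) r) (comp (inv C (e Y)) f)));
  [unfold e; smc|rewrite Q].
transitivity (comp (e X) (comp (comp (phia A (ginv l) r) (phia A (ginv l) (phia A l f)))
  (inv C (e X)))); [unfold e; smc|].
rewrite <- (phia_comp _ Hr (phia_hom l Hf)), E, phia_idm.
transitivity (comp (e X) (inv C (e X))); [unfold e; smc|].
exact (comp_inv_r (phicVl_hom l X) _).
Qed.

Lemma phicV_phi2 l X Y :
  comp (tensm (phic A l (ginv l) X) (phic A l (ginv l) Y))
    (comp (phi2 A l (phio A (ginv l) X) (phio A (ginv l) Y)) (phia A l (phi2 A (ginv l) X Y)))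
  = phic A l (ginv l) (tens X Y).
Proof. rewrite phic_phi2, gmulVr, phi2_one; smc. Qed.
Lemma phicVl_phi2 l X Y :
  comp (tensm (phic A (ginv l) l X) (phic A (ginv l) l Y))
    (comp (phi2 A (ginv l) (phio A l X) (phio A l Y)) (phia A (ginv l) (phi2 A l X Y)))
  = phic A (ginv l) l (tens X Y).
Proof. rewrite phic_phi2, gmulVl, phi2_one; smc. Qed.
Local Notation "f ∘ g" := (comp f g) (at level 41, right associativity).
Local Notation "f ⊗ g" := (tensm f g) (at level 39, right associativity).
Local Notation "X ⊠ Y" := (tens X Y) (at level 39, right associativity).
Local Notation ι := (@idm C).
Local Notation I1 := (munit C).
Local Notation "l ^-1" := (ginv l) (at level 2, format "l ^-1").
Local Notation P := (phio A).
Local Notation Pa := (phia A).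
Local Notation P2 := (phi2 A).
Local Notation P0 := (phi0 A).
Local Notation Pc := (phic A).

Ltac via e := transitivity e; [smc|].

(* A comonoidal functor with a comonoidal quasi-inverse is strong: [phi_l^2] is a split
   monomorphism since [phi_(l^-1)] reflects retractions, and a split epimorphism since every
   object is, up to isomorphism, in the image of [phi_(l^-1)]. *)
Local Instance phi2_iso l X Y : is_iso C (P2 l X Y).
Proof.
(* The proposed retraction comes from comonoidality of the compositor: by [phicVl_phi2], following
   [phi_(l^-1)(phi_l^2)] by the last two factors gives the compositor at [X ⊠ Y], which is
   invertible. *)
destruct (@phia_reflects_retraction l^-1 (P2 l X Y) (P l (X ⊠ Y)) (P l X ⊠ P l Y)
  (inv C (Pc l^-1 l (X ⊠ Y)) ∘ (Pc l^-1 l X ⊗ Pc l^-1 l Y) ∘ P2 l^-1 (P l X) (P l Y)))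
  as (r & Hr & Er); try (tc || smt).
{ via (inv C (Pc l^-1 l (X ⊠ Y)) ∘
     (Pc l^-1 l X ⊗ Pc l^-1 l Y) ∘ P2 l^-1 (P l X) (P l Y) ∘ Pa l^-1 (P2 l X Y)).
  rewrite phicVl_phi2; apply (comp_inv_l (phicVl_hom l _) _). }
apply (@iso_intro _ (P l (X ⊠ Y)) (P l X ⊠ P l Y) r
  (Pa l (Pc l^-1 l X ⊗ Pc l^-1 l Y) ∘ Pa l (P2 l^-1 (P l X) (P l Y))
   ∘ inv C (Pc l l^-1 (P l X ⊠ P l Y)))); try (tc || smt); trivial.
via ((P2 l X Y ∘ Pa l (Pc l^-1 l X ⊗ Pc l^-1 l Y)) ∘ Pa l (P2 l^-1 (P l X) (P l Y))
   ∘ inv C (Pc l l^-1 (P l X ⊠ P l Y))).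
(* The zigzag identity replaces the images under [phi_l] of the compositors at [(l^-1, l)] by
   compositors at [(l, l^-1)], the ones that [phicV_phi2] can absorb. *)
rewrite (phi2_nat l (phicVl_hom l X) (phicVl_hom l Y)), <- !phic_zigzag.
via (((Pc l l^-1 (P l X) ⊗ Pc l l^-1 (P l Y))
   ∘ P2 l (P l^-1 (P l X)) (P l^-1 (P l Y)) ∘ Pa l (P2 l^-1 (P l X) (P l Y)))
   ∘ inv C (Pc l l^-1 (P l X ⊠ P l Y))).
rewrite phicV_phi2; apply (comp_inv_r (phicV_hom l _) _).
Qed.

(** By [phic_phi0], the composite of [P0 l] with [Pa l (P0 l^-1)] is a compositor, hence invertible;
    this yields a right inverse. The same with [l] and [l^-1] exchanged yields a retraction after
    applying [phi_(l^-1)]. *)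
Local Instance phi0_iso l : is_iso C (P0 l).
Proof.
destruct (@phia_reflects_retraction l^-1 (P0 l) (P l I1) I1
  (inv C (Pc l^-1 l I1) ∘ P0 l^-1)) as (r & Hr & Er); try tc.
{ via (inv C (Pc l^-1 l I1) ∘ P0 l^-1 ∘ Pa l^-1 (P0 l)).
  rewrite <- phic_phi0, gmulVl, phi0_one.
  via (inv C (Pc l^-1 l I1) ∘ Pc l^-1 l I1).
  apply (comp_inv_l (phicVl_hom l _) _). }
apply (@iso_intro _ (P l I1) I1 r (Pa l (P0 l^-1) ∘ inv C (Pc l l^-1 I1)));
  try tc; trivial.
via ((P0 l ∘ Pa l (P0 l^-1)) ∘ inv C (Pc l l^-1 I1)).
rewrite <- phic_phi0, gmulVr, phi0_one.
via (Pc l l^-1 I1 ∘ inv C (Pc l l^-1 I1)).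
apply (comp_inv_r (phicV_hom l _) _).
Qed.

(** * Half-braidings *)

Local Coercion zob : ZOb >-> ob.
Local Notation d := (@zdeg C G).

Existing Class Z_isob.

Local Instance zhb_hom X V : Z_isob A X ->
  hom C (zhb X V) (X ⊠ V) (P (d X) V ⊠ X).
Proof. intros (_ & H & _); now apply H. Qed.

Local Instance zhb_iso X V : Z_isob A X -> is_iso C (zhb X V).
Proof. intros (_ & H & _); now apply H. Qed.

Lemma zhb_nat X f V W : Z_isob A X -> hom C f V W ->
  (Pa (d X) f ⊗ ι X) ∘ zhb X V = zhb X W ∘ (ι X ⊗ f).
Proof. intros (_ & _ & H & _) (Hf & <- & <-); now apply H. Qed.

Lemma zhb_tens X V W : Z_isob A X ->
  (P2 (d X) V W ⊗ ι X) ∘ zhb X (V ⊠ W)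
  = (ι (P (d X) V) ⊗ zhb X W) ∘ (zhb X V ⊗ ι W).
Proof. intros (_ & _ & _ & H & _); now apply H. Qed.

Lemma zhb_unit X : Z_isob A X -> (P0 (d X) ⊗ ι X) ∘ zhb X I1 = ι X.
Proof. intros (_ & _ & _ & _ & H); now apply H. Qed.

(** * The half-braiding of [Phi_o A l X] *)

Local Notation J l h := (gmul (gmul l h) (ginv l)).

(** A separate name permits a typing instance with unfolded endpoints and degree, available before
    [Phi_o A l X] is known to satisfy [Z_isob]. *)
Definition conj_hb (l : G) (X : ZOb C G) (V : ob C) : ar C := zhb (Phi_o A l X) V.

Local Instance phicJ_hom l h V :
  hom C (Pc (J l h) l V) (P (J l h) (P l V)) (P (gmul l h) V) | 0.
Proof. assert (H := phic_hom (J l h) l V); now rewrite gmulKV in H. Qed.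

Lemma conj_hbE l X V : conj_hb l X V =
  ((Pc (gmul l (d X)) l^-1 V ∘ Pc l (d X) (P l^-1 V)) ⊗ ι (P l X))
  ∘ (P2 l (P (d X) (P l^-1 V)) X
     ∘ Pa l (zhb X (P l^-1 V)) ∘ inv C (P2 l X (P l^-1 V)))
  ∘ (ι (P l X) ⊗ inv C (Pc l l^-1 V)).
Proof. reflexivity. Qed.

Local Instance conj_hb_hom l X V : Z_isob A X ->
  hom C (conj_hb l X V) (P l X ⊠ V) (P (J l (d X)) V ⊠ P l X).
Proof. intros HX; rewrite conj_hbE; smt. Qed.

Local Instance conj_hb_iso l X V : Z_isob A X -> is_iso C (conj_hb l X V).
Proof. intros HX; rewrite conj_hbE; tc. Qed.

Lemma inv_nat e e' f f' X Y X' Y' : hom C e X Y -> hom C e' X' Y' ->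
  is_iso C e -> is_iso C e' -> hom C f X X' -> hom C f' Y Y' ->
  e' ∘ f = f' ∘ e -> f ∘ inv C e = inv C e' ∘ f'.
Proof.
intros He He' Ie Ie' Hf Hf' E.
apply (@iso_cancel_l e' Y X' Y'); try tc.
via ((e' ∘ f) ∘ inv C e); rewrite E.
via (f' ∘ (e ∘ inv C e)); rewrite (comp_inv_r He Ie).
via (ι Y' ∘ f'); rewrite <- (comp_inv_r He' Ie'); smc.
Qed.

(** With [conj_hb_image], this is the only identity derived from the explicit formula. The arrow [f]
    is moved leftwards through the factors one at a time, past the inverted ones by [inv_nat]. *)
Lemma conj_hb_nat l X f V W : Z_isob A X -> hom C f V W ->
  (Pa (J l (d X)) f ⊗ ι (P l X)) ∘ conj_hb l X V
  = conj_hb l X W ∘ (ι (P l X) ⊗ f).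
Proof.
intros HX Hf; rewrite !conj_hbE.
set (f' := Pa l^-1 f).
assert (Hf' : hom C f' (P l^-1 V) (P l^-1 W)) by (unfold f'; tc).
assert (T : forall V, hom C (zhb X V) (X ⊠ V) (P (d X) V ⊠ X)) by (intros; now apply zhb_hom).
symmetry.
via (((Pc (gmul l (d X)) l^-1 W ∘ Pc l (d X) (P l^-1 W)) ⊗ ι (P l X))
  ∘ (P2 l (P (d X) (P l^-1 W)) X ∘ Pa l (zhb X (P l^-1 W)) ∘ inv C (P2 l X (P l^-1 W)))
  ∘ (ι (P l X) ⊗ (inv C (Pc l l^-1 W) ∘ f))).
rewrite <- (@inv_nat (Pc l l^-1 V) (Pc l l^-1 W) (Pa l (Pa l^-1 f)) f
  _ _ _ _ _ _ _ _ _ _ (phicV_nat l Hf)); fold f'.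
via (((Pc (gmul l (d X)) l^-1 W ∘ Pc l (d X) (P l^-1 W)) ⊗ ι (P l X))
  ∘ P2 l (P (d X) (P l^-1 W)) X ∘ Pa l (zhb X (P l^-1 W))
  ∘ (inv C (P2 l X (P l^-1 W)) ∘ (ι (P l X) ⊗ Pa l f'))
  ∘ (ι (P l X) ⊗ inv C (Pc l l^-1 V))).
rewrite <- (@inv_nat (P2 l X (P l^-1 V)) (P2 l X (P l^-1 W)) (Pa l (ι X ⊗ f')) (ι (P l X) ⊗ Pa l f')
  (P l (X ⊠ P l^-1 V)) (P l X ⊠ P l (P l^-1 V)) (P l (X ⊠ P l^-1 W)) (P l X ⊠ P l (P l^-1 W)) _ _ _ _ _ _).
2: { rewrite <- phia_idm; apply phi2_nat; tc. }
via (((Pc (gmul l (d X)) l^-1 W ∘ Pc l (d X) (P l^-1 W)) ⊗ ι (P l X))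
  ∘ P2 l (P (d X) (P l^-1 W)) X ∘ (Pa l (zhb X (P l^-1 W)) ∘ Pa l (ι X ⊗ f'))
  ∘ inv C (P2 l X (P l^-1 V)) ∘ (ι (P l X) ⊗ inv C (Pc l l^-1 V))).
rewrite <- (phia_comp l (T (P l^-1 W)) _), <- (zhb_nat HX Hf').
erewrite (phia_comp l) by tc.
via (((Pc (gmul l (d X)) l^-1 W ∘ Pc l (d X) (P l^-1 W)) ⊗ ι (P l X))
  ∘ (P2 l (P (d X) (P l^-1 W)) X ∘ Pa l (Pa (d X) f' ⊗ ι X)) ∘ Pa l (zhb X (P l^-1 V))
  ∘ inv C (P2 l X (P l^-1 V)) ∘ (ι (P l X) ⊗ inv C (Pc l l^-1 V))).
rewrite (phi2_nat l (phia_hom (d X) Hf') _), phia_idm.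
via (((Pc (gmul l (d X)) l^-1 W ∘ Pc l (d X) (P l^-1 W) ∘ Pa l (Pa (d X) f')) ⊗ ι (P l X))
  ∘ P2 l (P (d X) (P l^-1 V)) X ∘ Pa l (zhb X (P l^-1 V))
  ∘ inv C (P2 l X (P l^-1 V)) ∘ (ι (P l X) ⊗ inv C (Pc l l^-1 V))).
rewrite (phic_nat l (d X) Hf').
via ((((Pc (gmul l (d X)) l^-1 W ∘ Pa (gmul l (d X)) f') ∘ Pc l (d X) (P l^-1 V)) ⊗ ι (P l X))
  ∘ P2 l (P (d X) (P l^-1 V)) X ∘ Pa l (zhb X (P l^-1 V))
  ∘ inv C (P2 l X (P l^-1 V)) ∘ (ι (P l X) ⊗ inv C (Pc l l^-1 V))).
unfold f'; rewrite (phic_nat (gmul l (d X)) l^-1 Hf); smc.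
Qed.

Lemma phia_inv l f X Y : hom C f X Y -> is_iso C f -> inv C (Pa l f) = Pa l (inv C f).
Proof.
intros Hf If; apply (@inv_eq _ (P l X) (P l Y)); try tc.
rewrite <- (phia_comp l (hom_inv Hf If) Hf), (comp_inv_l Hf If); apply phia_idm.
Qed.

(* Characterises the half-braiding of [Phi_l X] without inverses: together with naturality,
   it determines it, because every object is isomorphic to some [phi_l V]. *)
Lemma conj_hb_image l X V : Z_isob A X ->
  (Pc (J l (d X)) l V ⊗ ι (P l X)) ∘ conj_hb l X (P l V) ∘ P2 l X V
  = (Pc l (d X) V ⊗ ι (P l X)) ∘ P2 l (P (d X) V) X ∘ Pa l (zhb X V).
Proof.
(* At an object [P l V] the zigzag identity turns the inverted compositor into an arrow in the image
   of [phi_l], so it can pass through [phi_l^2] by naturality. *)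
intros HX; rewrite conj_hbE, phic_zigzag.
rewrite (phia_inv l (phicVl_hom l V) _).
set (e := inv C (Pc l^-1 l V)).
assert (He : hom C e V (P l^-1 (P l V))) by (unfold e; tc).
via (((Pc (J l (d X)) l V ∘ Pc (gmul l (d X)) l^-1 (P l V) ∘ Pc l (d X) (P l^-1 (P l V))) ⊗ ι (P l X))
  ∘ P2 l (P (d X) (P l^-1 (P l V))) X ∘ Pa l (zhb X (P l^-1 (P l V))) ∘ inv C (P2 l X (P l^-1 (P l V)))
  ∘ (ι (P l X) ⊗ Pa l e) ∘ P2 l X V).
rewrite <- (phia_idm l X), <- (phi2_nat l (hom_idm HC HobC X) He), phia_idm.
via (((Pc (J l (d X)) l V ∘ Pc (gmul l (d X)) l^-1 (P l V) ∘ Pc l (d X) (P l^-1 (P l V))) ⊗ ι (P l X))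
  ∘ P2 l (P (d X) (P l^-1 (P l V))) X ∘ Pa l (zhb X (P l^-1 (P l V))) ∘ (inv C (P2 l X (P l^-1 (P l V)))
  ∘ P2 l X (P l^-1 (P l V))) ∘ Pa l (ι X ⊗ e)).
rewrite (comp_inv_l (phi2_hom l X (P l^-1 (P l V))) _).
via (((Pc (J l (d X)) l V ∘ Pc (gmul l (d X)) l^-1 (P l V) ∘ Pc l (d X) (P l^-1 (P l V))) ⊗ ι (P l X))
  ∘ P2 l (P (d X) (P l^-1 (P l V))) X ∘ (Pa l (zhb X (P l^-1 (P l V))) ∘ Pa l (ι X ⊗ e))).
rewrite <- (phia_comp l (zhb_hom (P l^-1 (P l V)) HX) _), <- (zhb_nat HX He).
erewrite (phia_comp l) by tc.
via (((Pc (J l (d X)) l V ∘ Pc (gmul l (d X)) l^-1 (P l V) ∘ Pc l (d X) (P l^-1 (P l V))) ⊗ ι (P l X))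
  ∘ (P2 l (P (d X) (P l^-1 (P l V))) X ∘ Pa l (Pa (d X) e ⊗ ι X)) ∘ Pa l (zhb X V)).
rewrite (phi2_nat l (phia_hom (d X) He) _), phia_idm.
via ((((Pc (J l (d X)) l V ∘ Pc (gmul l (d X)) l^-1 (P l V))
       ∘ Pc l (d X) (P l^-1 (P l V)) ∘ Pa l (Pa (d X) e)) ⊗ ι (P l X))
  ∘ P2 l (P (d X) V) X ∘ Pa l (zhb X V)).
(* The cocycle identity for [(lh, l^-1, l)] merges the two outer compositors into the image of
   [Pc l^-1 l V], which then cancels against [e]. *)
rewrite phic_cocycle, gmulVl, phic_one_r, (phic_nat l (d X) He).
via ((((Pa (gmul l (d X)) (Pc l^-1 l V) ∘ Pa (gmul l (d X)) e) ∘ Pc l (d X) V) ⊗ ι (P l X))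
  ∘ P2 l (P (d X) V) X ∘ Pa l (zhb X V)).
rewrite <- (phia_comp _ (phicVl_hom l V) He); unfold e.
rewrite (comp_inv_r (phicVl_hom l V) _), phia_idm; smc.
Qed.

(** The object [P l V ⊠ P l W] is not literally an image under [phi_l]. Precomposing with [P2 l V W]
    and using naturality replaces it by [P l (V ⊠ W)], where [conj_hb_image] applies. *)
Lemma conj_hb_tens_image l X V W : Z_isob A X ->
  (P2 (J l (d X)) (P l V) (P l W) ⊗ ι (P l X)) ∘ conj_hb l X (P l V ⊠ P l W)
  = (ι (P (J l (d X)) (P l V)) ⊗ conj_hb l X (P l W)) ∘ (conj_hb l X (P l V) ⊗ ι (P l W)).
Proof.
intros HX; set (k := J l (d X)).
assert (T : forall V, hom C (conj_hb l X V) (P l X ⊠ V) (P k V ⊠ P l X))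
  by (intros U; apply (conj_hb_hom l U HX)).
assert (T' : forall V, hom C (Pc k l V) (P k (P l V)) (P (gmul l (d X)) V))
  by (intros; apply phicJ_hom).
apply (@iso_cancel_l (Pc k l V ⊗ Pc k l W ⊗ ι (P l X))
  (P l X ⊠ P l V ⊠ P l W) (P k (P l V) ⊠ P k (P l W) ⊠ P l X)
  (P (gmul l (d X)) V ⊠ P (gmul l (d X)) W ⊠ P l X)); try tc; try smt.
apply (@iso_cancel_r ((ι (P l X) ⊗ P2 l V W) ∘ P2 l X (V ⊠ W))
  (P l (X ⊠ V ⊠ W)) (P l X ⊠ P l V ⊠ P l W)
  (P (gmul l (d X)) V ⊠ P (gmul l (d X)) W ⊠ P l X)); try tc; try smt.
(* The common value is, up to structure maps, [phi_l] of the right-hand side of [zhb_tens] for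
   [X]. *)
transitivity ((Pc l (d X) V ⊗ Pc l (d X) W ⊗ ι (P l X))
   ∘ (ι (P l (P (d X) V)) ⊗ P2 l (P (d X) W) X) ∘ (ι (P l (P (d X) V)) ⊗ Pa l (zhb X W))
   ∘ P2 l (P (d X) V) (X ⊠ W) ∘ Pa l (zhb X V ⊗ ι W)).
- via ((Pc k l V ⊗ Pc k l W ⊗ ι (P l X)) ∘ (P2 k (P l V) (P l W) ⊗ ι (P l X))
   ∘ (conj_hb l X (P l V ⊠ P l W) ∘ (ι (P l X) ⊗ P2 l V W)) ∘ P2 l X (V ⊠ W)).
  rewrite <- (conj_hb_nat l HX (phi2_hom l V W)); fold k.
  via ((((Pc k l V ⊗ Pc k l W) ∘ P2 k (P l V) (P l W) ∘ Pa k (P2 l V W)) ⊗ ι (P l X))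
   ∘ conj_hb l X (P l (V ⊠ W)) ∘ P2 l X (V ⊠ W)).
  unfold k at 1 2 3 4; rewrite phic_phi2, gmulKV; fold k.
  via ((P2 (gmul l (d X)) V W ⊗ ι (P l X)) ∘ (Pc k l (V ⊠ W) ⊗ ι (P l X))
   ∘ conj_hb l X (P l (V ⊠ W)) ∘ P2 l X (V ⊠ W)).
  unfold k; rewrite (conj_hb_image l (V ⊠ W) HX).
  via (((P2 (gmul l (d X)) V W ∘ Pc l (d X) (V ⊠ W)) ⊗ ι (P l X))
   ∘ P2 l (P (d X) (V ⊠ W)) X ∘ Pa l (zhb X (V ⊠ W))).
  rewrite <- phic_phi2.
  via (((Pc l (d X) V ⊗ Pc l (d X) W) ⊗ ι (P l X))
   ∘ (P2 l (P (d X) V) (P (d X) W) ⊗ ι (P l X))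
   ∘ ((Pa l (P2 (d X) V W) ⊗ ι (P l X)) ∘ P2 l (P (d X) (V ⊠ W)) X)
   ∘ Pa l (zhb X (V ⊠ W))).
  rewrite <- (phia_idm l X), <- (phi2_nat l (phi2_hom (d X) V W) _), phia_idm.
  via ((Pc l (d X) V ⊗ Pc l (d X) W ⊗ ι (P l X))
   ∘ ((P2 l (P (d X) V) (P (d X) W) ⊗ ι (P l X)) ∘ P2 l (P (d X) V ⊠ P (d X) W) X)
   ∘ (Pa l (P2 (d X) V W ⊗ ι X) ∘ Pa l (zhb X (V ⊠ W)))).
  rewrite <- (@phia_comp l _ _ (X ⊠ V ⊠ W) (P (d X) (V ⊠ W) ⊠ X)
     (P (d X) V ⊠ P (d X) W ⊠ X)) by (tc || smt).
  rewrite (zhb_tens V W HX), phi2_coassoc.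
  rewrite (@phia_comp l _ _ (X ⊠ V ⊠ W) (P (d X) V ⊠ X ⊠ W)
     (P (d X) V ⊠ P (d X) W ⊠ X)) by (tc || smt).
  via ((Pc l (d X) V ⊗ Pc l (d X) W ⊗ ι (P l X))
   ∘ (ι (P l (P (d X) V)) ⊗ P2 l (P (d X) W) X)
   ∘ (P2 l (P (d X) V) (P (d X) W ⊠ X) ∘ Pa l (ι (P (d X) V) ⊗ zhb X W))
   ∘ Pa l (zhb X V ⊗ ι W)).
  rewrite (phi2_nat l (hom_idm HC HobC (P (d X) V)) (zhb_hom W HX)), phia_idm; smc.
- symmetry.
  via ((Pc k l V ⊗ ((Pc k l W ⊗ ι (P l X)) ∘ conj_hb l X (P l W)))
   ∘ (conj_hb l X (P l V) ⊗ ι (P l W)) ∘ ((ι (P l X) ⊗ P2 l V W) ∘ P2 l X (V ⊠ W))).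
  rewrite <- phi2_coassoc.
  via ((ι (P (gmul l (d X)) V) ⊗ ((Pc k l W ⊗ ι (P l X)) ∘ conj_hb l X (P l W)))
   ∘ (((Pc k l V ⊗ ι (P l X)) ∘ conj_hb l X (P l V) ∘ P2 l X V) ⊗ ι (P l W))
   ∘ P2 l (X ⊠ V) W).
  unfold k at 2; rewrite (conj_hb_image l V HX).
  via ((Pc l (d X) V ⊗ ((Pc k l W ⊗ ι (P l X)) ∘ conj_hb l X (P l W)))
   ∘ (P2 l (P (d X) V) X ⊗ ι (P l W))
   ∘ ((Pa l (zhb X V) ⊗ ι (P l W)) ∘ P2 l (X ⊠ V) W)).
  rewrite <- (phia_idm l W), <- (phi2_nat l (zhb_hom V HX) _), phia_idm.
  via ((Pc l (d X) V ⊗ ((Pc k l W ⊗ ι (P l X)) ∘ conj_hb l X (P l W)))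
   ∘ ((P2 l (P (d X) V) X ⊗ ι (P l W)) ∘ P2 l (P (d X) V ⊠ X) W) ∘ Pa l (zhb X V ⊗ ι W)).
  rewrite phi2_coassoc.
  via ((Pc l (d X) V ⊗ ((Pc k l W ⊗ ι (P l X)) ∘ conj_hb l X (P l W) ∘ P2 l X W))
   ∘ P2 l (P (d X) V) (X ⊠ W) ∘ Pa l (zhb X V ⊗ ι W)).
  unfold k; rewrite (conj_hb_image l W HX); smc.
Qed.

Lemma conj_hb_tens l X V W : Z_isob A X ->
  (P2 (J l (d X)) V W ⊗ ι (P l X)) ∘ conj_hb l X (V ⊠ W)
  = (ι (P (J l (d X)) V) ⊗ conj_hb l X W) ∘ (conj_hb l X V ⊗ ι W).
Proof.
intros HX.
assert (E := conj_hb_tens_image l (P l^-1 V) (P l^-1 W) HX).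
assert (He := phicV_hom l V); assert (He' := phicV_hom l W).
assert (Ie := phic_iso l l^-1 V); assert (Ie' := phic_iso l l^-1 W).
(* Only the fact that [e] and [e'] are isomorphisms onto [V] and [W] matters from here on; the
   tensor axiom is transported along them by naturality. *)
set (e := Pc l l^-1 V) in *; set (e' := Pc l l^-1 W) in *; clearbody e e'.
set (V' := P l (P l^-1 V)) in *; set (W' := P l (P l^-1 W)) in *; clearbody V' W'.
apply (@iso_cancel_r (ι (P l X) ⊗ e ⊗ e') (P l X ⊠ V' ⊠ W') (P l X ⊠ V ⊠ W)
  (P (J l (d X)) V ⊠ P (J l (d X)) W ⊠ P l X)); try tc; try smt.
via ((P2 (J l (d X)) V W ⊗ ι (P l X)) ∘ (conj_hb l X (V ⊠ W) ∘ (ι (P l X) ⊗ (e ⊗ e')))).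
erewrite <- (conj_hb_nat l HX) by tc.
via (((P2 (J l (d X)) V W ∘ Pa (J l (d X)) (e ⊗ e')) ⊗ ι (P l X)) ∘ conj_hb l X (V' ⊠ W')).
rewrite (phi2_nat _ He He').
via ((Pa (J l (d X)) e ⊗ Pa (J l (d X)) e' ⊗ ι (P l X))
  ∘ (P2 (J l (d X)) V' W' ⊗ ι (P l X)) ∘ conj_hb l X (V' ⊠ W')).
rewrite E; symmetry.
via ((ι (P (J l (d X)) V) ⊗ (conj_hb l X W ∘ (ι (P l X) ⊗ e')))
  ∘ ((conj_hb l X V ∘ (ι (P l X) ⊗ e)) ⊗ ι W')).
rewrite <- (conj_hb_nat l HX He), <- (conj_hb_nat l HX He'); smc.
Qed.

Lemma conj_hb_unit l X : Z_isob A X ->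
  (P0 (J l (d X)) ⊗ ι (P l X)) ∘ conj_hb l X I1 = ι (P l X).
Proof.
intros HX.
via ((P0 (J l (d X)) ⊗ ι (P l X)) ∘ conj_hb l X I1 ∘ (ι (P l X) ⊗ ι I1)).
(* The identity of [P l X] is expanded by the counit law of [phi_l]. This brings in [P0 l], along
   which the unit object is replaced by [P l I1]. *)
transitivity ((P0 (J l (d X)) ⊗ ι (P l X)) ∘ conj_hb l X I1
  ∘ (ι (P l X) ⊗ P0 l) ∘ P2 l X I1).
{ rewrite phi2_counit_r; smc. }
via ((P0 (J l (d X)) ⊗ ι (P l X)) ∘ (conj_hb l X I1 ∘ (ι (P l X) ⊗ P0 l)) ∘ P2 l X I1).
rewrite <- (conj_hb_nat l HX (phi0_hom l)).
via (((P0 (J l (d X)) ∘ Pa (J l (d X)) (P0 l)) ⊗ ι (P l X))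
  ∘ conj_hb l X (P l I1) ∘ P2 l X I1).
rewrite <- phic_phi0, gmulKV.
via ((P0 (gmul l (d X)) ⊗ ι (P l X)) ∘ ((Pc (J l (d X)) l I1 ⊗ ι (P l X))
  ∘ conj_hb l X (P l I1) ∘ P2 l X I1)).
rewrite (conj_hb_image l I1 HX).
via (((P0 (gmul l (d X)) ∘ Pc l (d X) I1) ⊗ ι (P l X))
  ∘ P2 l (P (d X) I1) X ∘ Pa l (zhb X I1)).
rewrite phic_phi0.
via ((P0 l ⊗ ι (P l X)) ∘ ((Pa l (P0 (d X)) ⊗ ι (P l X))
  ∘ P2 l (P (d X) I1) X) ∘ Pa l (zhb X I1)).
rewrite <- (phia_idm l X), <- (phi2_nat l (phi0_hom (d X)) _), phia_idm.
via ((P0 l ⊗ ι (P l X)) ∘ P2 l I1 X ∘ (Pa l (P0 (d X) ⊗ ι X) ∘ Pa l (zhb X I1))).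
rewrite <- (@phia_comp l _ _ X (P (d X) I1 ⊠ X) X) by smt.
rewrite (zhb_unit HX), phia_idm.
via ((P0 l ⊗ ι (P l X)) ∘ P2 l I1 X); apply phi2_counit_l.
Qed.

Lemma half_braiding_intro k X gam :
  (forall V, hom C (gam V) (X ⊠ V) (P k V ⊠ X)) ->
  (forall V, is_iso C (gam V)) ->
  (forall f V W, hom C f V W -> (Pa k f ⊗ ι X) ∘ gam V = gam W ∘ (ι X ⊗ f)) ->
  (forall V W, (P2 k V W ⊗ ι X) ∘ gam (V ⊠ W) = (ι (P k V) ⊗ gam W) ∘ (gam V ⊗ ι W)) ->
  (P0 k ⊗ ι X) ∘ gam I1 = ι X ->
  is_half_braiding (ac A k) X gam.
Proof.
intros H1 H2 H3 H4 H5; repeat split; try apply H1; try apply H2; trivial.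
- intros f Hf; now apply H3.
- intros V W _ _; apply H4.
Qed.

Local Instance Phi_isob l X : Z_isob A X -> Z_isob A (Phi_o A l X).
Proof.
intros HX; split; [apply HobC|apply half_braiding_intro].
- intros V; apply (conj_hb_hom l V HX).
- intros V; apply (conj_hb_iso l V HX).
- intros f V W; apply (conj_hb_nat l HX).
- intros V W; apply (conj_hb_tens l V W HX).
- apply (conj_hb_unit l HX).
Qed.

Local Instance unit_isob : Z_isob A (Z_unit C G).
Proof.
split; [apply HobC|apply half_braiding_intro]; simpl.
- intros V; smt.
- intros V; tc.
- intros f V W Hf; rewrite (phia_one Hf); smc.
- intros V W; rewrite phi2_one; smc.
- rewrite phi0_one; smc.
Qed.

(** * The half-braiding of a tensor product *)

Definition tens_hb (X Y : ZOb C G) (V : ob C) : ar C :=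
  (Pc (d X) (d Y) V ⊗ ι (X ⊠ Y)) ∘ (zhb X (P (d Y) V) ⊗ ι Y) ∘ (ι X ⊗ zhb Y V).

Local Instance tens_hb_hom X Y V : Z_isob A X -> Z_isob A Y ->
  hom C (tens_hb X Y V) (X ⊠ Y ⊠ V) (P (gmul (d X) (d Y)) V ⊠ X ⊠ Y).
Proof. intros HX HY; unfold tens_hb; smt. Qed.

Lemma tens_hb_nat X Y f V W : Z_isob A X -> Z_isob A Y -> hom C f V W ->
  (Pa (gmul (d X) (d Y)) f ⊗ ι (X ⊠ Y)) ∘ tens_hb X Y V = tens_hb X Y W ∘ (ι (X ⊠ Y) ⊗ f).
Proof.
intros HX HY Hf; unfold tens_hb.
via (((Pa (gmul (d X) (d Y)) f ∘ Pc (d X) (d Y) V) ⊗ ι (X ⊠ Y))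
  ∘ (zhb X (P (d Y) V) ⊗ ι Y) ∘ (ι X ⊗ zhb Y V)).
rewrite <- (phic_nat _ _ Hf).
via ((Pc (d X) (d Y) W ⊗ ι (X ⊠ Y))
  ∘ (((Pa (d X) (Pa (d Y) f) ⊗ ι X) ∘ zhb X (P (d Y) V)) ⊗ ι Y) ∘ (ι X ⊗ zhb Y V)).
rewrite (zhb_nat HX (phia_hom (d Y) Hf)).
via ((Pc (d X) (d Y) W ⊗ ι (X ⊠ Y)) ∘ (zhb X (P (d Y) W) ⊗ ι Y)
  ∘ (ι X ⊗ ((Pa (d Y) f ⊗ ι Y) ∘ zhb Y V))).
rewrite (zhb_nat HY Hf); smc.
Qed.

Lemma tens_hb_tens X Y V W : Z_isob A X -> Z_isob A Y ->
  (P2 (gmul (d X) (d Y)) V W ⊗ ι (X ⊠ Y)) ∘ tens_hb X Y (V ⊠ W)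
  = (ι (P (gmul (d X) (d Y)) V) ⊗ tens_hb X Y W) ∘ (tens_hb X Y V ⊗ ι W).
Proof.
intros HX HY; unfold tens_hb.
via (((P2 (gmul (d X) (d Y)) V W ∘ Pc (d X) (d Y) (V ⊠ W)) ⊗ ι (X ⊠ Y))
  ∘ (zhb X (P (d Y) (V ⊠ W)) ⊗ ι Y) ∘ (ι X ⊗ zhb Y (V ⊠ W))).
rewrite <- phic_phi2.
via (((Pc (d X) (d Y) V ⊗ Pc (d X) (d Y) W) ⊗ ι (X ⊠ Y))
  ∘ (P2 (d X) (P (d Y) V) (P (d Y) W) ⊗ ι (X ⊠ Y))
  ∘ (((Pa (d X) (P2 (d Y) V W) ⊗ ι X) ∘ zhb X (P (d Y) (V ⊠ W))) ⊗ ι Y)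
  ∘ (ι X ⊗ zhb Y (V ⊠ W))).
rewrite (zhb_nat HX (phi2_hom (d Y) V W)).
via (((Pc (d X) (d Y) V ⊗ Pc (d X) (d Y) W) ⊗ ι (X ⊠ Y))
  ∘ (((P2 (d X) (P (d Y) V) (P (d Y) W) ⊗ ι X) ∘ zhb X (P (d Y) V ⊠ P (d Y) W)) ⊗ ι Y)
  ∘ (ι X ⊗ ((P2 (d Y) V W ⊗ ι Y) ∘ zhb Y (V ⊠ W)))).
rewrite (zhb_tens _ _ HX), (zhb_tens _ _ HY); smc.
Qed.

Lemma tens_hb_unit X Y : Z_isob A X -> Z_isob A Y ->
  (P0 (gmul (d X) (d Y)) ⊗ ι (X ⊠ Y)) ∘ tens_hb X Y I1 = ι (X ⊠ Y).
Proof.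
intros HX HY; unfold tens_hb.
via (((P0 (gmul (d X) (d Y)) ∘ Pc (d X) (d Y) I1) ⊗ ι (X ⊠ Y))
  ∘ (zhb X (P (d Y) I1) ⊗ ι Y) ∘ (ι X ⊗ zhb Y I1)).
rewrite phic_phi0.
via ((P0 (d X) ⊗ ι (X ⊠ Y))
  ∘ (((Pa (d X) (P0 (d Y)) ⊗ ι X) ∘ zhb X (P (d Y) I1)) ⊗ ι Y) ∘ (ι X ⊗ zhb Y I1)).
rewrite (zhb_nat HX (phi0_hom (d Y))).
via ((((P0 (d X) ⊗ ι X) ∘ zhb X I1) ⊗ ι Y) ∘ (ι X ⊗ ((P0 (d Y) ⊗ ι Y) ∘ zhb Y I1))).
rewrite (zhb_unit HX), (zhb_unit HY); smc.
Qed.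

Lemma tens_hb_iso X Y V : Z_isob A X -> Z_isob A Y -> is_iso C (tens_hb X Y V).
Proof.
intros HX HY; unfold tens_hb.
apply (@iso_comp _ _ (X ⊠ Y ⊠ V) (P (d X) (P (d Y) V) ⊠ X ⊠ Y)
  (P (gmul (d X) (d Y)) V ⊠ X ⊠ Y)); try tc; try smt.
apply (@iso_comp _ _ (X ⊠ Y ⊠ V) (X ⊠ P (d Y) V ⊠ Y)
  (P (d X) (P (d Y) V) ⊠ X ⊠ Y)); try tc; smt.
Qed.

Local Instance tens_isob X Y : Z_isob A X -> Z_isob A Y -> Z_isob A (Z_tens A X Y).
Proof.
intros HX HY; split; [apply HobC|apply half_braiding_intro].
- intros V; assert (H := tens_hb_hom V HX HY); now rewrite <- tensoA in H.
- intros V; apply (tens_hb_iso V HX HY).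
- intros f V W; apply (tens_hb_nat HX HY).
- intros V W; apply (tens_hb_tens V W HX HY).
- apply (tens_hb_unit HX HY).
Qed.

(** * Compatibility of arrows with half-braidings *)

Definition hb_compat (X Y : ZOb C G) (f : ar C) (V : ob C) : Prop :=
  (ι (P (d X) V) ⊗ f) ∘ zhb X V = zhb Y V ∘ (f ⊗ ι V).

(** Naturality of both half-braidings transports the condition along [e]. This is how the conditions
    below are reduced to objects in the image of the action. *)
Lemma hb_compat_iso X Y f e U V : Z_isob A X -> Z_isob A Y -> d X = d Y -> hom C f X Y ->
  hom C e U V -> is_iso C e -> hb_compat X Y f U -> hb_compat X Y f V.
Proof.
unfold hb_compat; intros HX HY E Hf He Ie H.
(* The degrees agree only through [E], so the type of [zhb Y V] is restated with [d X], the form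
   needed for the syntactic comparison of objects. *)
assert (T : forall V, hom C (zhb Y V) (Y ⊠ V) (P (d X) V ⊠ Y))
  by (intros W; rewrite E; apply (zhb_hom W HY)).
apply (@iso_cancel_r (ι X ⊗ e) (X ⊠ U) (X ⊠ V) (P (d X) V ⊠ Y)); try tc.
via ((ι (P (d X) V) ⊗ f) ∘ (zhb X V ∘ (ι X ⊗ e))).
rewrite <- (zhb_nat HX He).
via ((Pa (d X) e ⊗ ι Y) ∘ (ι (P (d X) U) ⊗ f) ∘ zhb X U).
rewrite H.
via (((Pa (d X) e ⊗ ι Y) ∘ zhb Y U) ∘ (f ⊗ ι U)).
assert (K := zhb_nat HY He); rewrite <- E in K; rewrite K; smc.
Qed.

Lemma Phi_a_compat l X Y f V : Z_isob A X -> Z_isob A Y -> d X = d Y -> hom C f X Y ->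
  (forall V, hb_compat X Y f V) -> hb_compat (Phi_o A l X) (Phi_o A l Y) (Pa l f) V.
Proof.
intros HX HY E Hf H.
apply (@hb_compat_iso (Phi_o A l X) (Phi_o A l Y) (Pa l f) (Pc l l^-1 V) (P l (P l^-1 V)));
  try tc; [simpl; now rewrite E|].
generalize (P l^-1 V); clear V; intros V; red.
change ((ι (P (J l (d X)) (P l V)) ⊗ Pa l f) ∘ conj_hb l X (P l V)
  = conj_hb l Y (P l V) ∘ (Pa l f ⊗ ι (P l V))).
assert (T : forall V, hom C (conj_hb l Y V) (P l Y ⊠ V) (P (J l (d X)) V ⊠ P l Y))
  by (intros W; rewrite E; apply (conj_hb_hom l W HY)).
assert (T' : forall V, hom C (zhb Y V) (Y ⊠ V) (P (d X) V ⊠ Y))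
  by (intros W; rewrite E; apply (zhb_hom W HY)).
apply (@iso_cancel_l (Pc (J l (d X)) l V ⊗ ι (P l Y)) (P l X ⊠ P l V)
  (P (J l (d X)) (P l V) ⊠ P l Y) (P (gmul l (d X)) V ⊠ P l Y)); try tc.
apply (@iso_cancel_r (P2 l X V) (P l (X ⊠ V)) (P l X ⊠ P l V)
  (P (gmul l (d X)) V ⊠ P l Y)); try tc.
via ((ι (P (gmul l (d X)) V) ⊗ Pa l f) ∘ ((Pc (J l (d X)) l V ⊗ ι (P l X))
  ∘ conj_hb l X (P l V) ∘ P2 l X V)).
rewrite (conj_hb_image l V HX).
via ((Pc l (d X) V ⊗ ι (P l Y)) ∘ ((ι (P l (P (d X) V)) ⊗ Pa l f) ∘ P2 l (P (d X) V) X)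
  ∘ Pa l (zhb X V)).
rewrite <- (phia_idm l (P (d X) V)), <- (phi2_nat l (hom_idm HC HobC (P (d X) V)) Hf), ?phia_idm.
via ((Pc l (d X) V ⊗ ι (P l Y)) ∘ P2 l (P (d X) V) Y
  ∘ (Pa l (ι (P (d X) V) ⊗ f) ∘ Pa l (zhb X V))).
rewrite <- (@phia_comp l _ _ (X ⊠ V) (P (d X) V ⊠ X) (P (d X) V ⊠ Y)) by tc.
rewrite (H V); symmetry.
via ((Pc (J l (d X)) l V ⊗ ι (P l Y)) ∘ conj_hb l Y (P l V)
  ∘ ((Pa l f ⊗ ι (P l V)) ∘ P2 l X V)).
rewrite <- (phia_idm l V), <- (phi2_nat l Hf (hom_idm HC HobC V)), ?phia_idm.
via (((Pc (J l (d X)) l V ⊗ ι (P l Y)) ∘ conj_hb l Y (P l V) ∘ P2 l Y V) ∘ Pa l (f ⊗ ι V)).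
assert (K := conj_hb_image l V HY); rewrite <- E in K; rewrite K.
rewrite (@phia_comp l _ _ (X ⊠ V) (Y ⊠ V) (P (d X) V ⊠ Y)) by tc; smc.
Qed.

(** On an object [P l V] the equation [conj_hb_image] is used three times: for the tensor product,
    for [Y] at [V], and for [X] at [P (d Y) V]. Cocycle and coassociativity identities join
    these. *)
Lemma phi2_compat l X Y V : Z_isob A X -> Z_isob A Y ->
  hb_compat (Phi_o A l (Z_tens A X Y)) (Z_tens A (Phi_o A l X) (Phi_o A l Y)) (P2 l X Y) V.
Proof.
intros HX HY.
assert (HXY := tens_isob HX HY).
apply (@hb_compat_iso (Phi_o A l (Z_tens A X Y)) (Z_tens A (Phi_o A l X) (Phi_o A l Y))
  (P2 l X Y) (Pc l l^-1 V) (P l (P l^-1 V))); try tc.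
{ simpl; autorewrite with diagram; reflexivity. }
generalize (P l^-1 V); clear V; intros V; red.
assert (H := conj_hb_image l V HXY).
assert (T : hom C (conj_hb l (Z_tens A X Y) (P l V)) (P l (X ⊠ Y) ⊠ P l V)
  (P (J l (gmul (d X) (d Y))) (P l V) ⊠ P l (X ⊠ Y))) by apply (conj_hb_hom l (P l V) HXY).
change (zhb (Phi_o A l (Z_tens A X Y))) with (conj_hb l (Z_tens A X Y)).
(* From here this half-braiding is known only through its type [T] and its characterising equation
   [H]. *)
set (delta := conj_hb l (Z_tens A X Y) (P l V)) in *; clearbody delta.
change (zhb (Z_tens A X Y) V) with (tens_hb X Y V) in H; cbn [zob zdeg Z_tens] in H.
change ((ι (P (J l (gmul (d X) (d Y))) (P l V)) ⊗ P2 l X Y) ∘ delta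
  = ((Pc (J l (d X)) (J l (d Y)) (P l V) ⊗ ι (P l X ⊠ P l Y))
     ∘ (conj_hb l X (P (J l (d Y)) (P l V)) ⊗ ι (P l Y))
     ∘ (ι (P l X) ⊗ conj_hb l Y (P l V))) ∘ (P2 l X Y ⊗ ι (P l V))).
apply (@iso_cancel_l (Pc (J l (gmul (d X) (d Y))) l V ⊗ ι (P l X ⊠ P l Y))
  (P l (X ⊠ Y) ⊠ P l V)
  (P (J l (gmul (d X) (d Y))) (P l V) ⊠ P l X ⊠ P l Y)
  (P (gmul l (gmul (d X) (d Y))) V ⊠ P l X ⊠ P l Y)); try tc; try smt.
apply (@iso_cancel_r (P2 l (X ⊠ Y) V) (P l ((X ⊠ Y) ⊠ V)) (P l (X ⊠ Y) ⊠ P l V)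
  (P (gmul l (gmul (d X) (d Y))) V ⊠ P l X ⊠ P l Y)); try tc; try smt.
transitivity (((Pc (gmul l (d X)) (d Y) V ∘ Pc l (d X) (P (d Y) V)) ⊗ ι (P l X ⊠ P l Y))
  ∘ (P2 l (P (d X) (P (d Y) V)) X ⊗ ι (P l Y)) ∘ (Pa l (zhb X (P (d Y) V)) ⊗ ι (P l Y))
  ∘ P2 l (X ⊠ P (d Y) V) Y ∘ Pa l (ι X ⊗ zhb Y V)).
- via ((ι (P (gmul l (gmul (d X) (d Y))) V) ⊗ P2 l X Y)
    ∘ ((Pc (J l (gmul (d X) (d Y))) l V ⊗ ι (P l (X ⊠ Y))) ∘ delta ∘ P2 l (X ⊠ Y) V)).
  rewrite H; unfold tens_hb.
  rewrite (@phia_comp l (Pc (d X) (d Y) V ⊗ ι (X ⊠ Y)) _ (X ⊠ Y ⊠ V)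
    (P (d X) (P (d Y) V) ⊠ X ⊠ Y) (P (gmul (d X) (d Y)) V ⊠ X ⊠ Y)) by smt.
  rewrite (@phia_comp l _ _ (X ⊠ Y ⊠ V) (X ⊠ P (d Y) V ⊠ Y)
    (P (d X) (P (d Y) V) ⊠ X ⊠ Y)) by smt.
  via ((Pc l (gmul (d X) (d Y)) V ⊗ P2 l X Y)
    ∘ (P2 l (P (gmul (d X) (d Y)) V) (X ⊠ Y) ∘ Pa l (Pc (d X) (d Y) V ⊗ ι (X ⊠ Y)))
    ∘ Pa l (zhb X (P (d Y) V) ⊗ ι Y) ∘ Pa l (ι X ⊗ zhb Y V)).
  rewrite (phi2_nat l (phic_hom (d X) (d Y) V) (hom_idm HC HobC (X ⊠ Y))), ?phia_idm.
  via (((Pc l (gmul (d X) (d Y)) V ∘ Pa l (Pc (d X) (d Y) V)) ⊗ ι (P l X ⊠ P l Y))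
    ∘ ((ι (P l (P (d X) (P (d Y) V))) ⊗ P2 l X Y) ∘ P2 l (P (d X) (P (d Y) V)) (X ⊠ Y))
    ∘ Pa l (zhb X (P (d Y) V) ⊗ ι Y) ∘ Pa l (ι X ⊗ zhb Y V)).
  rewrite <- phic_cocycle, <- phi2_coassoc.
  via (((Pc (gmul l (d X)) (d Y) V ∘ Pc l (d X) (P (d Y) V)) ⊗ ι (P l X ⊠ P l Y))
    ∘ (P2 l (P (d X) (P (d Y) V)) X ⊗ ι (P l Y))
    ∘ (P2 l (P (d X) (P (d Y) V) ⊠ X) Y ∘ Pa l (zhb X (P (d Y) V) ⊗ ι Y))
    ∘ Pa l (ι X ⊗ zhb Y V)).
  rewrite (phi2_nat l (zhb_hom (P (d Y) V) HX) (hom_idm HC HobC Y)), phia_idm; smc.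
- symmetry.
  via (((Pc (gmul (J l (d X)) (J l (d Y))) l V ∘ Pc (J l (d X)) (J l (d Y)) (P l V))
     ⊗ ι (P l X ⊠ P l Y))
    ∘ (conj_hb l X (P (J l (d Y)) (P l V)) ⊗ ι (P l Y))
    ∘ (ι (P l X) ⊗ conj_hb l Y (P l V)) ∘ ((P2 l X Y ⊗ ι (P l V)) ∘ P2 l (X ⊠ Y) V)).
  rewrite phic_cocycle, phi2_coassoc, (gmulKV G (gmul l (d Y)) l).
  via ((Pc (J l (d X)) (gmul l (d Y)) V ⊗ ι (P l X ⊠ P l Y))
    ∘ (((Pa (J l (d X)) (Pc (J l (d Y)) l V) ⊗ ι (P l X))
        ∘ conj_hb l X (P (J l (d Y)) (P l V))) ⊗ ι (P l Y))
    ∘ (ι (P l X) ⊗ conj_hb l Y (P l V)) ∘ (ι (P l X) ⊗ P2 l Y V) ∘ P2 l X (Y ⊠ V)).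
  rewrite (conj_hb_nat l HX (phicJ_hom l (d Y) V)).
  via ((Pc (J l (d X)) (gmul l (d Y)) V ⊗ ι (P l X ⊠ P l Y))
    ∘ (conj_hb l X (P (gmul l (d Y)) V) ⊗ ι (P l Y))
    ∘ (ι (P l X) ⊗ ((Pc (J l (d Y)) l V ⊗ ι (P l Y)) ∘ conj_hb l Y (P l V) ∘ P2 l Y V))
    ∘ P2 l X (Y ⊠ V)).
  rewrite (conj_hb_image l V HY).
  via ((Pc (J l (d X)) (gmul l (d Y)) V ⊗ ι (P l X ⊠ P l Y))
    ∘ ((conj_hb l X (P (gmul l (d Y)) V) ∘ (ι (P l X) ⊗ Pc l (d Y) V)) ⊗ ι (P l Y))
    ∘ (ι (P l X) ⊗ P2 l (P (d Y) V) Y)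
    ∘ ((ι (P l X) ⊗ Pa l (zhb Y V)) ∘ P2 l X (Y ⊠ V))).
  rewrite <- (conj_hb_nat l HX (phic_hom l (d Y) V)).
  rewrite <- (phia_idm l X), <- (phi2_nat l (hom_idm HC HobC X) (zhb_hom V HY)), ?phia_idm.
  via (((Pc (J l (d X)) (gmul l (d Y)) V ∘ Pa (J l (d X)) (Pc l (d Y) V))
     ⊗ ι (P l X ⊠ P l Y))
    ∘ (conj_hb l X (P l (P (d Y) V)) ⊗ ι (P l Y))
    ∘ ((ι (P l X) ⊗ P2 l (P (d Y) V) Y) ∘ P2 l X (P (d Y) V ⊠ Y)) ∘ Pa l (ι X ⊗ zhb Y V)).
  rewrite <- phic_cocycle, <- phi2_coassoc, gmulKV.
  via ((Pc (gmul l (d X)) (d Y) V ⊗ ι (P l X ⊠ P l Y))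
    ∘ (((Pc (J l (d X)) l (P (d Y) V) ⊗ ι (P l X)) ∘ conj_hb l X (P l (P (d Y) V))
        ∘ P2 l X (P (d Y) V)) ⊗ ι (P l Y))
    ∘ P2 l (X ⊠ P (d Y) V) Y ∘ Pa l (ι X ⊗ zhb Y V)).
  rewrite (conj_hb_image l (P (d Y) V) HX); smc.
Qed.

(** For the unit the characterising equation says that [delta] carries [P2 l I1 V] to [P2 l V I1];
    the two counit laws then make both sides identities. *)
Lemma phi0_compat l V : hb_compat (Phi_o A l (Z_unit C G)) (Z_unit C G) (P0 l) V.
Proof.
apply (@hb_compat_iso (Phi_o A l (Z_unit C G)) (Z_unit C G) (P0 l)
  (Pc l l^-1 V) (P l (P l^-1 V))); try tc.
{ simpl; autorewrite with diagram; reflexivity. }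
generalize (P l^-1 V); clear V; intros V; red.
assert (H := conj_hb_image l V unit_isob).
assert (T := conj_hb_hom l (P l V) unit_isob).
change (zhb (Phi_o A l (Z_unit C G))) with (conj_hb l (Z_unit C G)).
set (delta := conj_hb l (Z_unit C G) (P l V)) in *; clearbody delta.
cbn [zob zdeg zhb Z_unit Phi_o] in *.
rewrite gmul1r, gmulVr in *.
rewrite phic_one_l, phic_one_r, phia_idm in H.
apply (@iso_cancel_r (P2 l I1 V) (P l V) (P l I1 ⊠ P l V) (P l V)); try tc; try smt.
via ((ι (P l V) ⊗ P0 l) ∘ (ι (P l V) ⊗ ι (P l I1)) ∘ delta ∘ P2 l I1 V).
autorewrite with diagram in *; rewrite H.
via ((ι (P l V) ⊗ P0 l) ∘ P2 l V I1).
rewrite phi2_counit_r; symmetry.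
via ((P0 l ⊗ ι (P l V)) ∘ P2 l I1 V); apply phi2_counit_l.
Qed.

Lemma phic_compat g h X V : Z_isob A X ->
  hb_compat (Phi_o A g (Phi_o A h X)) (Phi_o A (gmul g h) X) (Pc g h X) V.
Proof.
intros HX.
assert (HhX := Phi_isob h HX).
(* Two successive images are required, since [conj_hb_image] is applied for [g] over an object
   [P h V] and then for [h] over [V]. The isomorphism is accordingly a composite of two
   compositors. *)
apply (@hb_compat_iso (Phi_o A g (Phi_o A h X)) (Phi_o A (gmul g h) X) (Pc g h X)
  (Pc g g^-1 V ∘ Pa g (Pc h h^-1 (P g^-1 V))) (P g (P h (P h^-1 (P g^-1 V))))); try tc.
{ simpl; autorewrite with diagram; reflexivity. }
generalize (P h^-1 (P g^-1 V)); clear V; intros V; red.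
assert (H := conj_hb_image g (P h V) HhX).
assert (T : hom C (conj_hb g (Phi_o A h X) (P g (P h V))) (P g (P h X) ⊠ P g (P h V))
  (P (J g (J h (d X))) (P g (P h V)) ⊠ P g (P h X)))
  by apply (conj_hb_hom g (P g (P h V)) HhX).
change (zhb (Phi_o A g (Phi_o A h X))) with (conj_hb g (Phi_o A h X)).
set (delta := conj_hb g (Phi_o A h X) (P g (P h V))) in *; clearbody delta.
change (zhb (Phi_o A h X) (P h V)) with (conj_hb h X (P h V)) in H.
cbn [zob zdeg Phi_o] in H.
change ((ι (P (J g (J h (d X))) (P g (P h V))) ⊗ Pc g h X) ∘ delta
  = conj_hb (gmul g h) X (P g (P h V)) ∘ (Pc g h X ⊗ ι (P g (P h V)))).
apply (@iso_cancel_l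
  ((Pc (J g (J h (d X))) (gmul g h) V ∘ Pa (J g (J h (d X))) (Pc g h V)) ⊗ ι (P (gmul g h) X))
  (P g (P h X) ⊠ P g (P h V)) (P (J g (J h (d X))) (P g (P h V)) ⊠ P (gmul g h) X)
  (P (gmul (J g (J h (d X))) (gmul g h)) V ⊠ P (gmul g h) X)); try tc; try smt.
apply (@iso_cancel_r (P2 g (P h X) (P h V) ∘ Pa g (P2 h X V))
  (P g (P h (X ⊠ V))) (P g (P h X) ⊠ P g (P h V))
  (P (gmul (J g (J h (d X))) (gmul g h)) V ⊠ P (gmul g h) X)); try tc; try smt.
transitivity ((Pc (gmul g h) (d X) V ⊗ ι (P (gmul g h) X)) ∘ P2 (gmul g h) (P (d X) V) X
  ∘ Pa (gmul g h) (zhb X V) ∘ Pc g h (X ⊠ V)).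
- rewrite <- phic_cocycle.
  via ((Pc (gmul (J g (J h (d X))) g) h V ⊗ Pc g h X)
    ∘ ((Pc (J g (J h (d X))) g (P h V) ⊗ ι (P g (P h X))) ∘ delta ∘ P2 g (P h X) (P h V))
    ∘ Pa g (P2 h X V)).
  rewrite H, (gmulKV G (gmul g (J h (d X))) g).
  via (((Pc (gmul g (J h (d X))) h V ∘ Pc g (J h (d X)) (P h V)) ⊗ Pc g h X)
    ∘ P2 g (P (J h (d X)) (P h V)) (P h X)
    ∘ (Pa g (conj_hb h X (P h V)) ∘ Pa g (P2 h X V))).
  rewrite phic_cocycle, (gmulKV G (gmul h (d X)) h).
  rewrite <- (phia_comp g (conj_hb_hom h (P h V) HX) (phi2_hom h X V)).
  via ((Pc g (gmul h (d X)) V ⊗ Pc g h X)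
    ∘ ((Pa g (Pc (J h (d X)) h V) ⊗ ι (P g (P h X))) ∘ P2 g (P (J h (d X)) (P h V)) (P h X))
    ∘ Pa g (conj_hb h X (P h V) ∘ P2 h X V)).
  rewrite <- (phia_idm g (P h X)),
    <- (phi2_nat g (phicJ_hom h (d X) V) (hom_idm HC HobC (P h X))), ?phia_idm.
  via ((Pc g (gmul h (d X)) V ⊗ Pc g h X) ∘ P2 g (P (gmul h (d X)) V) (P h X)
    ∘ (Pa g (Pc (J h (d X)) h V ⊗ ι (P h X)) ∘ Pa g (conj_hb h X (P h V) ∘ P2 h X V))).
  rewrite <- (@phia_comp g _ _ (P h (X ⊠ V)) (P (J h (d X)) (P h V) ⊠ P h X)
    (P (gmul h (d X)) V ⊠ P h X)) by tc.
  rewrite (conj_hb_image h V HX).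
  rewrite (@phia_comp g (Pc h (d X) V ⊗ ι (P h X)) _ (P h (X ⊠ V)) (P h (P (d X) V) ⊠ P h X)
    (P (gmul h (d X)) V ⊠ P h X)) by tc.
  rewrite (@phia_comp g _ _ (P h (X ⊠ V)) (P h (P (d X) V ⊠ X)) (P h (P (d X) V) ⊠ P h X))
    by tc.
  via ((Pc g (gmul h (d X)) V ⊗ Pc g h X)
    ∘ (P2 g (P (gmul h (d X)) V) (P h X) ∘ Pa g (Pc h (d X) V ⊗ ι (P h X)))
    ∘ Pa g (P2 h (P (d X) V) X) ∘ Pa g (Pa h (zhb X V))).
  rewrite (phi2_nat g (phic_hom h (d X) V) (hom_idm HC HobC (P h X))), ?phia_idm.
  via (((Pc g (gmul h (d X)) V ∘ Pa g (Pc h (d X) V)) ⊗ Pc g h X)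
    ∘ P2 g (P h (P (d X) V)) (P h X) ∘ Pa g (P2 h (P (d X) V) X) ∘ Pa g (Pa h (zhb X V))).
  rewrite <- phic_cocycle.
  via ((Pc (gmul g h) (d X) V ⊗ ι (P (gmul g h) X))
    ∘ ((Pc g h (P (d X) V) ⊗ Pc g h X) ∘ P2 g (P h (P (d X) V)) (P h X)
       ∘ Pa g (P2 h (P (d X) V) X)) ∘ Pa g (Pa h (zhb X V))).
  rewrite phic_phi2.
  via ((Pc (gmul g h) (d X) V ⊗ ι (P (gmul g h) X)) ∘ P2 (gmul g h) (P (d X) V) X
    ∘ (Pc g h (P (d X) V ⊠ X) ∘ Pa g (Pa h (zhb X V)))).
  rewrite (phic_nat g h (zhb_hom V HX)); reflexivity.
- symmetry.
  via ((Pc (J (gmul g h) (d X)) (gmul g h) V ⊗ ι (P (gmul g h) X))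
    ∘ ((Pa (J (gmul g h) (d X)) (Pc g h V) ⊗ ι (P (gmul g h) X))
       ∘ conj_hb (gmul g h) X (P g (P h V)))
    ∘ (Pc g h X ⊗ ι (P g (P h V))) ∘ P2 g (P h X) (P h V) ∘ Pa g (P2 h X V)).
  rewrite (conj_hb_nat (gmul g h) HX (phic_hom g h V)).
  via ((Pc (J (gmul g h) (d X)) (gmul g h) V ⊗ ι (P (gmul g h) X))
    ∘ conj_hb (gmul g h) X (P (gmul g h) V)
    ∘ ((Pc g h X ⊗ Pc g h V) ∘ P2 g (P h X) (P h V) ∘ Pa g (P2 h X V))).
  rewrite phic_phi2.
  via (((Pc (J (gmul g h) (d X)) (gmul g h) V ⊗ ι (P (gmul g h) X))
    ∘ conj_hb (gmul g h) X (P (gmul g h) V) ∘ P2 (gmul g h) X V) ∘ Pc g h (X ⊠ V)).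
  rewrite (conj_hb_image (gmul g h) V HX); smc.
Qed.

(** Here the half-braiding of [Phi_o A (d X) Y] is already evaluated at an image [P (d X) V], so
    [conj_hb_image] applies directly. What remains is the Yang-Baxter argument: naturality of
    [zhb X] at the arrow [zhb Y V], between two uses of [zhb_tens]. *)
Lemma braiding_compat X Y V : Z_isob A X -> Z_isob A Y ->
  hb_compat (Z_tens A X Y) (Z_tens A (Phi_o A (d X) Y) X) (zhb X Y) V.
Proof.
intros HX HY; red.
change ((ι (P (gmul (d X) (d Y)) V) ⊗ zhb X Y) ∘ tens_hb X Y V
  = ((Pc (J (d X) (d Y)) (d X) V ⊗ ι (P (d X) Y ⊠ X))
     ∘ (conj_hb (d X) Y (P (d X) V) ⊗ ι X) ∘ (ι (P (d X) Y) ⊗ zhb X V)) ∘ (zhb X Y ⊗ ι V)).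
symmetry.
via ((Pc (J (d X) (d Y)) (d X) V ⊗ ι (P (d X) Y ⊠ X)) ∘ (conj_hb (d X) Y (P (d X) V) ⊗ ι X)
  ∘ ((ι (P (d X) Y) ⊗ zhb X V) ∘ (zhb X Y ⊗ ι V))).
rewrite <- (zhb_tens Y V HX).
via ((((Pc (J (d X) (d Y)) (d X) V ⊗ ι (P (d X) Y)) ∘ conj_hb (d X) Y (P (d X) V)
    ∘ P2 (d X) Y V) ⊗ ι X) ∘ zhb X (Y ⊠ V)).
rewrite (conj_hb_image (d X) V HY).
via ((Pc (d X) (d Y) V ⊗ ι (P (d X) Y ⊠ X)) ∘ (P2 (d X) (P (d Y) V) Y ⊗ ι X)
  ∘ ((Pa (d X) (zhb Y V) ⊗ ι X) ∘ zhb X (Y ⊠ V))).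
rewrite (zhb_nat HX (zhb_hom V HY)).
via ((Pc (d X) (d Y) V ⊗ ι (P (d X) Y ⊠ X))
  ∘ ((P2 (d X) (P (d Y) V) Y ⊗ ι X) ∘ zhb X (P (d Y) V ⊠ Y)) ∘ (ι X ⊗ zhb Y V)).
rewrite (zhb_tens _ _ HX); unfold tens_hb; smc.
Qed.

Lemma tensm_compat X X' Y Y' f g V : Z_isob A X -> Z_isob A X' -> Z_isob A Y -> Z_isob A Y' ->
  d X = d X' -> d Y = d Y' -> hom C f X X' -> hom C g Y Y' ->
  (forall V, hb_compat X X' f V) -> (forall V, hb_compat Y Y' g V) ->
  hb_compat (Z_tens A X Y) (Z_tens A X' Y') (f ⊗ g) V.
Proof.
intros HX HX' HY HY' E E' Hf Hg Kf Kg; red.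
assert (T : forall V, hom C (zhb X' V) (X' ⊠ V) (P (d X) V ⊠ X'))
  by (intros W; rewrite E; apply (zhb_hom W HX')).
assert (T' : forall V, hom C (zhb Y' V) (Y' ⊠ V) (P (d Y) V ⊠ Y'))
  by (intros W; rewrite E'; apply (zhb_hom W HY')).
change ((ι (P (gmul (d X) (d Y)) V) ⊗ f ⊗ g) ∘ tens_hb X Y V
  = tens_hb X' Y' V ∘ ((f ⊗ g) ⊗ ι V)).
unfold tens_hb; rewrite <- E, <- E'.
via ((Pc (d X) (d Y) V ⊗ ι (X' ⊠ Y'))
  ∘ (((ι (P (d X) (P (d Y) V)) ⊗ f) ∘ zhb X (P (d Y) V)) ⊗ ι Y')
  ∘ (ι X ⊗ ((ι (P (d Y) V) ⊗ g) ∘ zhb Y V))).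
rewrite (Kf (P (d Y) V)), (Kg V); smc.
Qed.

(** * The crossed center *)

(** Strictness of [ZG A] and [Phi_e = Id] are equalities of objects, hence of half-braidings as
    functions; this is where functional extensionality enters. *)
Lemma ZOb_eq (X Y : ZOb C G) : d X = d Y -> zob X = zob Y ->
  (forall V, zhb X V = zhb Y V) -> X = Y.
Proof.
destruct X as [k x hx], Y as [k' y hy]; simpl; intros -> -> H.
now rewrite (functional_extensionality _ _ H).
Qed.

Lemma ZAr_eq (a b : ZAr C G) :
  zsrc a = zsrc b -> ztgt a = ztgt b -> zmor a = zmor b -> a = b.
Proof. destruct a, b; simpl; now intros -> -> ->. Qed.

(** The bracketings differ in the order in which the degrees are multiplied by compositors.
    Naturality of [zhb X] at a compositor brings them together, and the cocycle identity compares
    them. *)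
Lemma Z_tensA X Y Z : Z_isob A X -> Z_isob A Y -> Z_isob A Z ->
  Z_tens A X (Z_tens A Y Z) = Z_tens A (Z_tens A X Y) Z.
Proof.
intros HX HY HZ; apply ZOb_eq; [apply gmulA|simpl; now rewrite tensoA|intros V].
change (Pc (d X) (gmul (d Y) (d Z)) V ⊗ ι (X ⊠ Y ⊠ Z)
    ∘ zhb X (P (gmul (d Y) (d Z)) V) ⊗ ι (Y ⊠ Z) ∘ ι X ⊗ tens_hb Y Z V
  = Pc (gmul (d X) (d Y)) (d Z) V ⊗ ι ((X ⊠ Y) ⊠ Z)
    ∘ tens_hb X Y (P (d Z) V) ⊗ ι Z ∘ ι (X ⊠ Y) ⊗ zhb Z V).
unfold tens_hb.
via (Pc (d X) (gmul (d Y) (d Z)) V ⊗ ι (X ⊠ Y ⊠ Z)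
  ∘ (zhb X (P (gmul (d Y) (d Z)) V) ∘ (ι X ⊗ Pc (d Y) (d Z) V)) ⊗ ι (Y ⊠ Z)
  ∘ ι X ⊗ (zhb Y (P (d Z) V) ⊗ ι Z ∘ ι Y ⊗ zhb Z V)).
rewrite <- (zhb_nat HX (phic_hom (d Y) (d Z) V)).
via ((Pc (d X) (gmul (d Y) (d Z)) V ∘ Pa (d X) (Pc (d Y) (d Z) V)) ⊗ ι (X ⊠ Y ⊠ Z)
  ∘ zhb X (P (d Y) (P (d Z) V)) ⊗ ι (Y ⊠ Z)
  ∘ ι X ⊗ (zhb Y (P (d Z) V) ⊗ ι Z ∘ ι Y ⊗ zhb Z V)).
rewrite <- phic_cocycle; smc.
Qed.

Lemma Z_tens1l X : Z_isob A X -> Z_tens A (Z_unit C G) X = X.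
Proof.
intros HX; apply ZOb_eq; [apply gmul1l|apply tenso1l; auto|intros V].
change (Pc gone (d X) V ⊗ ι (I1 ⊠ X) ∘ ι (P (d X) V) ⊗ ι X ∘ ι I1 ⊗ zhb X V = zhb X V).
rewrite phic_one_l; smc.
Qed.

Lemma Z_tens1r X : Z_isob A X -> Z_tens A X (Z_unit C G) = X.
Proof.
intros HX; apply ZOb_eq; [apply gmul1r|apply tenso1r; auto|intros V].
change (Pc (d X) gone V ⊗ ι (X ⊠ I1) ∘ zhb X (P gone V) ⊗ ι I1 ∘ ι X ⊗ ι V = zhb X V).
rewrite phic_one_r, phio_one; smc.
Qed.

(** For [l = e] every [V] is literally [phi_e V], and in [conj_hb_image] all structure maps become
    identities, leaving the equality of half-braidings. *)
Lemma Phi_one X : Z_isob A X -> Phi_o A gone X = X.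
Proof.
intros HX; apply ZOb_eq.
- simpl; now rewrite ginv_gone, gmul1l, gmul1r.
- apply phio_one.
- intros V; change (conj_hb gone X V = zhb X V).
  assert (H := conj_hb_image gone V HX).
  rewrite (phia_one (zhb_hom V HX)), !phi2_one, phic_one_r, phic_one_l, !phio_one in H.
  via (ι (P (J gone (d X)) V) ⊗ ι X ∘ conj_hb gone X V ∘ ι (X ⊠ V)).
  rewrite H; smc.
Qed.

Lemma Z_isar_intro X Y f : Z_isob A X -> Z_isob A Y -> d X = d Y -> hom C f X Y ->
  (forall V, hb_compat X Y f V) -> Z_isar A {| zsrc := X; ztgt := Y; zmor := f |}.
Proof.
intros HX HY E Hf K; split; [|split; [|split; [|split]]]; trivial.
intros V _; apply K.
Qed.

Lemma Z_isarP a : Z_isar A a -> Z_isob A (zsrc a) /\ Z_isob A (ztgt a) /\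
  d (zsrc a) = d (ztgt a) /\ hom C (zmor a) (zsrc a) (ztgt a) /\
  (forall V, hb_compat (zsrc a) (ztgt a) (zmor a) V).
Proof.
intros (HX & HY & E & Hf & K); split; [|split; [|split; [|split]]]; trivial.
intros V; apply (K V), HobC.
Qed.

Lemma Z_idm_isar X : Z_isob A X -> Z_isar A (@idm (ZG A) X).
Proof.
intros HX; apply Z_isar_intro; trivial; try tc.
intros V; red; smc.
Qed.

Lemma Z_comp_isar (f g : ZAr C G) : Z_isar A f -> Z_isar A g -> zsrc f = ztgt g ->
  Z_isar A (@comp (ZG A) f g).
Proof.
destruct f as [Y' Z f], g as [X Y g]; intros Hf Hg E; simpl in E; subst Y'.
destruct (Z_isarP Hf) as (HY & HZ & E & Tf & Kf);
  destruct (Z_isarP Hg) as (HX & _ & E' & Tg & Kg); cbn [zsrc ztgt zmor] in *.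
apply Z_isar_intro; cbn [zsrc ztgt zmor]; trivial; try tc; [congruence|].
intros V; specialize (Kf V); specialize (Kg V); red in Kf, Kg; red.
assert (T : hom C (zhb Y V) (Y ⊠ V) (P (d X) V ⊠ Y))
  by (rewrite E'; apply (zhb_hom V HY)).
assert (T' : hom C (zhb Z V) (Z ⊠ V) (P (d X) V ⊠ Z))
  by (rewrite E', E; apply (zhb_hom V HZ)).
rewrite <- E' in Kf.
via (ι (P (d X) V) ⊗ f ∘ (ι (P (d X) V) ⊗ g ∘ zhb X V)); rewrite Kg.
via ((ι (P (d X) V) ⊗ f ∘ zhb Y V) ∘ g ⊗ ι V); rewrite Kf; smc.
Qed.

Lemma Z_tensm_isar (f g : ZAr C G) : Z_isar A f -> Z_isar A g ->
  Z_isar A (@tensm (ZG A) f g).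
Proof.
destruct f as [X X' f], g as [Y Y' g]; intros Hf Hg.
destruct (Z_isarP Hf) as (HX & HX' & E & Tf & Kf);
  destruct (Z_isarP Hg) as (HY & HY' & E' & Tg & Kg); cbn [zsrc ztgt zmor] in *.
apply Z_isar_intro; cbn [zsrc ztgt zmor]; try tc.
- simpl; congruence.
- intros V; now apply tensm_compat.
Qed.

Lemma ZG_strict_monoidal : is_strict_monoidal (ZG A).
Proof.
split; cbn [ob ar isob isar dom cod ZG].
- intros f Hf; split; apply Hf.
- intros X HX; split; [now apply Z_idm_isar|easy].
- intros f g Hf Hg E; split; [now apply Z_comp_isar|easy].
- intros f Hf; apply ZAr_eq; trivial; simpl.
  destruct (Z_isarP Hf) as (_ & _ & _ & Tf & _); smc.
- intros f Hf; apply ZAr_eq; trivial; simpl.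
  destruct (Z_isarP Hf) as (_ & _ & _ & Tf & _); smc.
- intros f g h Hf Hg Hh E E'; apply ZAr_eq; trivial; simpl.
  destruct (Z_isarP Hf) as (_ & _ & _ & Tf & _).
  destruct (Z_isarP Hg) as (_ & _ & _ & Tg & _).
  destruct (Z_isarP Hh) as (_ & _ & _ & Th & _).
  rewrite E in Tf; rewrite E' in Tg; smc.
- exact unit_isob.
- intros X Y; apply tens_isob.
- intros f g Hf Hg; split; [now apply Z_tensm_isar|easy].
- intros X Y HX HY; apply ZAr_eq; trivial; simpl; smc.
- intros f f' g g' Hf Hf' Hg Hg' E E'; apply ZAr_eq; trivial; simpl.
  destruct (Z_isarP Hf) as (_ & _ & _ & Tf & _).
  destruct (Z_isarP Hg) as (_ & _ & _ & Tg & _).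
  destruct (Z_isarP Hf') as (_ & _ & _ & Tf' & _).
  destruct (Z_isarP Hg') as (_ & _ & _ & Tg' & _).
  rewrite E in Tf; rewrite E' in Tg; smc.
- intros X Y Z; apply Z_tensA.
- intros X; apply Z_tens1l.
- intros X; apply Z_tens1r.
- intros f g h Hf Hg Hh.
  destruct (Z_isarP Hf) as (? & ? & _ & Tf & _).
  destruct (Z_isarP Hg) as (? & ? & _ & Tg & _).
  destruct (Z_isarP Hh) as (? & ? & _ & Th & _).
  apply ZAr_eq; [now apply Z_tensA|now apply Z_tensA|simpl; smc].
- intros f Hf; destruct (Z_isarP Hf) as (? & ? & _ & Tf & _).
  apply ZAr_eq; [now apply Z_tens1l|now apply Z_tens1l|simpl; smc].
- intros f Hf; destruct (Z_isarP Hf) as (? & ? & _ & Tf & _).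
  apply ZAr_eq; [now apply Z_tens1r|now apply Z_tens1r|simpl; smc].
Qed.

Lemma ZG_graded : @is_Ggraded (ZG A) G d.
Proof. repeat split; intros f Hf; apply Hf. Qed.

(** The inverse taken in [C] satisfies the morphism condition, as one sees by cancelling [f].
    Invertibility of all structure maps below is thus inherited from [C]. *)
Lemma Z_iso_intro a : Z_isar A a -> is_iso C (zmor a) -> is_iso (ZG A) a.
Proof.
intros Ha Ia; split; [exact Ha|].
destruct a as [X Y f]; destruct (Z_isarP Ha) as (HX & HY & E & Tf & Kf);
  cbn [zsrc ztgt zmor] in *.
exists {| zsrc := Y; ztgt := X; zmor := inv C f |}; split; [split; [|easy]|split].
- apply Z_isar_intro; trivial; try tc; [congruence|].
  intros V; red; rewrite <- E.
  assert (T : hom C (zhb Y V) (Y ⊠ V) (P (d X) V ⊠ Y))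
    by (rewrite E; apply (zhb_hom V HY)).
  apply (@iso_cancel_l (ι (P (d X) V) ⊗ f) (Y ⊠ V) (P (d X) V ⊠ X) (P (d X) V ⊠ Y)); try tc.
  via (ι (P (d X) V) ⊗ (f ∘ inv C f) ∘ zhb Y V); rewrite (comp_inv_r Tf Ia); symmetry.
  via ((ι (P (d X) V) ⊗ f ∘ zhb X V) ∘ inv C f ⊗ ι V); rewrite (Kf V).
  via (zhb Y V ∘ (f ∘ inv C f) ⊗ ι V); rewrite (comp_inv_r Tf Ia); smc.
- apply ZAr_eq; trivial; exact (comp_inv_l Tf Ia).
- apply ZAr_eq; trivial; exact (comp_inv_r Tf Ia).
Qed.

(** * The action on the crossed center *)

Lemma Phi_a_isar l a : Z_isar A a -> Z_isar A (Phi_a A l a).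
Proof.
intros Ha; destruct (Z_isarP Ha) as (HX & HY & E & Tf & Kf).
apply Z_isar_intro; try tc; [simpl; now rewrite E|].
intros V; now apply Phi_a_compat.
Qed.

Lemma Phi_2_isar l X Y : Z_isob A X -> Z_isob A Y -> Z_isar A (cf2 (PhiFun A l) X Y).
Proof.
intros HX HY; apply Z_isar_intro; try tc.
- simpl; autorewrite with diagram; reflexivity.
- intros V; now apply phi2_compat.
Qed.

Lemma Phi_0_isar l : Z_isar A (cf0 (PhiFun A l)).
Proof.
apply Z_isar_intro; try tc.
- simpl; autorewrite with diagram; reflexivity.
- intros V; now apply phi0_compat.
Qed.

Lemma Phi_c_isar g h X : Z_isob A X -> Z_isar A (acc (PhiZ A) g h X).
Proof.
intros HX; apply Z_isar_intro; try tc.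
- simpl; autorewrite with diagram; reflexivity.
- intros V; now apply phic_compat.
Qed.

Lemma Phi_functor l : is_functor (PhiFun A l).
Proof.
split; [|split; [|split]]; cbn [ob ar isob isar dom cod ZG].
- intros X; apply (Phi_isob l).
- intros f Hf; split; [now apply Phi_a_isar|easy].
- intros X HX; apply ZAr_eq; trivial; apply phia_idm.
- intros f g Hf Hg E; apply ZAr_eq; trivial; simpl.
  destruct (Z_isarP Hf) as (_ & _ & _ & Tf & _).
  destruct (Z_isarP Hg) as (_ & _ & _ & Tg & _).
  rewrite E in Tf; apply (phia_comp l Tf Tg).
Qed.

Lemma Phi_comonoidal l : is_comonoidal (PhiFun A l).
Proof.
split; [apply Phi_functor|]; split; [|split; [|split; [|split]]];
  cbn [ob ar isob isar dom cod ZG].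
- intros X Y HX HY; split; [now apply Phi_2_isar|easy].
- split; [apply Phi_0_isar|easy].
- intros f g Hf Hg; apply ZAr_eq; trivial; simpl.
  destruct (Z_isarP Hf) as (_ & _ & _ & Tf & _).
  destruct (Z_isarP Hg) as (_ & _ & _ & Tg & _).
  apply (phi2_nat l Tf Tg).
(* Arrows of [ZG A] record their endpoints, so these must be equal as objects with half-braidings.
   [Z_tens] and [Phi_o] stay folded to let [Z_tensA] rewrite them. *)
- intros X Y Z HX HY HZ; apply ZAr_eq; cbn -[Z_tens Phi_o].
  + now rewrite Z_tensA.
  + symmetry; apply Z_tensA; tc.
  + apply phi2_coassoc.
- intros X HX; split; apply ZAr_eq; cbn -[Z_tens Phi_o].
  + now rewrite Z_tens1r.
  + apply Z_tens1r; tc.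
  + apply phi2_counit_r.
  + now rewrite Z_tens1l.
  + apply Z_tens1l; tc.
  + apply phi2_counit_l.
Qed.

Lemma Phi_strong l : is_strong_comonoidal (PhiFun A l).
Proof.
split; [apply Phi_comonoidal|split].
- intros X Y HX HY; apply Z_iso_intro; [now apply Phi_2_isar|apply phi2_iso].
- apply Z_iso_intro; [apply Phi_0_isar|apply phi0_iso].
Qed.

Lemma Phi_c_comonoidal g h :
  is_comonoidal_nat (cf_comp (PhiFun A h) (PhiFun A g)) (PhiFun A (gmul g h))
    (acc (PhiZ A) g h).
Proof.
split; [|split; [|split]]; cbn [ob ar isob isar dom cod ZG].
- intros X HX; split; [now apply Phi_c_isar|easy].
- intros f Hf; destruct (Z_isarP Hf) as (_ & _ & _ & Tf & _).
  apply ZAr_eq; trivial; apply (phic_nat g h Tf).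
- intros X Y HX HY; apply ZAr_eq; trivial; apply phic_phi2.
- apply ZAr_eq; trivial; apply phic_phi0.
Qed.

Lemma Phi_action : is_action (PhiZ A).
Proof.
split; [exact Phi_comonoidal|].
split; [exact Phi_one|].
split.
{ intros f Hf; destruct (Z_isarP Hf) as (HX & HY & _ & Tf & _).
  apply ZAr_eq; [now apply Phi_one|now apply Phi_one|apply (phia_one Tf)]. }
split.
{ intros X Y HX HY; apply ZAr_eq; cbn -[Z_tens Phi_o].
  - apply Phi_one; now apply tens_isob.
  - now rewrite !Phi_one.
  - apply phi2_one. }
split.
{ apply ZAr_eq; [exact (Phi_one unit_isob)|easy|exact phi0_one]. }
split; [exact Phi_c_comonoidal|].
split; [intros g h X HX; apply Z_iso_intro; [now apply Phi_c_isar|apply phic_iso]|].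
split.
{ intros g h k X HX; apply ZAr_eq; cbn -[Phi_o]; [easy|now rewrite gmulA|apply phic_cocycle]. }
intros g X HX; split; apply ZAr_eq; cbn -[Phi_o].
- now rewrite (Phi_one HX).
- now rewrite gmul1r.
- apply phic_one_r.
- apply Phi_one; now apply (Phi_isob g).
- now rewrite gmul1l.
- apply phic_one_l.
Qed.

(** * The braiding *)

Lemma cZ_isar X Y : Z_isob A X -> Z_isob A Y -> Z_isar A (cZ A X Y).
Proof.
intros HX HY; apply Z_isar_intro; try tc.
- simpl; autorewrite with diagram; reflexivity.
- intros V; now apply braiding_compat.
Qed.

(** Axiom (i) is the definition of the half-braiding on a tensor product and (ii) is the tensor
    axiom of [zhb X]. Naturality in the second variable is that of [zhb X]; in the first it is the
    condition defining morphisms. *)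
Lemma cZ_braiding : @is_Gbraiding (ZG A) G d (PhiZ A) (@cZ C G A).
Proof.
split; [|split; [|split; [|split]]]; cbn [ob ar isob isar dom cod ZG].
- intros X Y HX HY; assert (Hc := cZ_isar HX HY); split; [now split|].
  now apply Z_iso_intro, zhb_iso.
- intros f g Hf Hg.
  destruct (Z_isarP Hf) as (HX & HX' & E & Tf & Kf).
  destruct (Z_isarP Hg) as (HY & HY' & _ & Tg & _).
  apply ZAr_eq; cbn -[Z_tens Phi_o]; [easy|now rewrite E|].
  destruct f as [X X' f], g as [Y Y' g]; cbn [zsrc ztgt zmor] in *.
  change (Pa (d X) g ⊗ f ∘ zhb X Y = zhb X' Y' ∘ f ⊗ g).
  assert (T : forall V, hom C (zhb X' V) (X' ⊠ V) (P (d X) V ⊠ X'))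
    by (intros W; rewrite E; apply (zhb_hom W HX')).
  via (ι (P (d X) Y') ⊗ f ∘ (Pa (d X) g ⊗ ι X ∘ zhb X Y)).
  rewrite (zhb_nat HX Tg).
  via ((ι (P (d X) Y') ⊗ f ∘ zhb X Y') ∘ ι X ⊗ g).
  rewrite (Kf Y'); smc.
- intros X Y Z HX HY HZ; apply ZAr_eq; cbn -[Z_tens Phi_o]; [|easy|easy].
  symmetry; now apply Z_tensA.
- intros X Y Z HX HY HZ; apply ZAr_eq; cbn -[Z_tens Phi_o].
  + now apply Z_tensA.
  + symmetry; apply Z_tensA; tc.
  + apply (zhb_tens Y Z HX).
- intros k X Y HX HY; apply ZAr_eq; cbn -[Z_tens Phi_o]; [easy| |].
  + simpl (d (Phi_o A k X)); now rewrite gmulKV.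
  + symmetry; apply (conj_hb_image k Y HX).
Qed.

End CrossedCenter.

Theorem mainTheorem5 (G : Grp) (C : MonCat) (A : ActData C G)
  (HC : is_strict_monoidal C)
  (HobC : forall X : ob C, isob X)
  (HA : is_action A) :
  (* Z_G(C) is a G-graded strict monoidal category with components Z_g(C) *)
  is_strict_monoidal (ZG A) /\
  @is_Ggraded (ZG A) G (@zdeg C G) /\
  (* (1) each Phi_g is strong comonoidal with Phi_g^2 = phi_g^2, Phi_g^0 = phi_g^0 *)
  (forall g : G, is_strong_comonoidal (PhiFun A g)) /\
  (* (2) g |-> Phi_g, with compositors phi_{g,h,X}, is a G-crossed action *)
  is_action (PhiZ A) /\
  @is_Gcrossed (ZG A) G (@zdeg C G) (PhiZ A) /\
  (* (3) c_{X,Y} := gamma^g_{X,Y} is a G-braiding *)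
  @is_Gbraiding (ZG A) G (@zdeg C G) (PhiZ A) (@cZ C G A).
Proof.
split; [now apply ZG_strict_monoidal|].
split; [apply ZG_graded|].
split; [now apply Phi_strong|].
assert (H : is_action (PhiZ A)) by now apply Phi_action.
split; [exact H|].
split; [|now apply cZ_braiding].
split; [apply ZG_graded|now split].
Qed.
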